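(* Let $\mathcal{C}$ be a $3$-uniform clutter on a vertex set $V=\{v_1,\ldots,v_n\}$, let $I=I(\mathcal{C})\subseteq \mathbb{K}[x_1,\ldots,x_n]$ be its edge ideal, and let $\mathscr{C}=\{\mathcal{B},\mathcal{B}_1,\mathcal{B}_2,\mathcal{B}'\}$ be the family of four $3$-uniform clutters defined in the context. The following conditions are equivalent: (a) the complement $\bar{\mathcal{C}}$ is $\mathscr{C}$-free; (b) $\mathrm{index}(I)>1$, that is, $I$ is linearly presented; (c) $\beta_{1,5}(I)=\beta_{1,6}(I)=0$.
   Context: $\mathbb{K}$ is a field and $S=\mathbb{K}[x_1,\ldots,x_n]$ has the standard grading; all ideals whose index is considered are nonzero. A $3$-uniform clutter $\mathcal{C}$ on a finite vertex set $V=\{v_1,\dots,v_n\}$ is a collection of $3$-subsets of $V$ (circuits) with $V=\bigcup\mathcal{C}$. Its edge ideal is $I(\mathcal{C})=(x_ix_jx_k : \{v_i,v_j,v_k\}\in\mathcal{C})$. Its complement is $\bar{\mathcal{C}}=\{F\subset V: |F|=3,\ F\notin\mathcal{C}\}$. Induced subclutters: for $W\subseteq V$, $\bar{\mathcal{C}}[W]=\{F\in\bar{\mathcal{C}}: F\subseteq W\}$. For a family $\mathscr{F}$ of clutters, a clutter is $\mathscr{F}$-free if it has no induced subclutter isomorphic to a member of $\mathscr{F}$, i.e. there are no $W\subseteq V$ and $\mathcal{D}\in\mathscr{F}$ with a bijection from $W$ onto the vertex set $\bigcup\mathcal{D}$ carrying the induced subclutter on $W$ onto $\mathcal{D}$.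 The family $\mathscr{C}=\{\mathcal{B},\mathcal{B}_1,\mathcal{B}_2,\mathcal{B}'\}$ (writing $abc$ for $\{a,b,c\}$): $\mathcal{B}=\{123,124,134,235,245,345\}$ (the bi-pyramid over the triangle with vertices $2,3,4$ and apexes $1,5$), $\mathcal{B}_1=\mathcal{B}\cup\{125\}$, $\mathcal{B}_2=\mathcal{B}\cup\{125,135\}$, and $\mathcal{B}'=\binom{[6]}{3}\setminus\{123,456\}$, the set of all $3$-subsets of $\{1,\dots,6\}$ other than $123$ and $456$. Graded Betti numbers: $\beta_{i,j}(I)=\dim_{\mathbb{K}}\mathrm{Tor}^S_i(\mathbb{K},I)_j$ (Betti numbers of the module $I$, so $\beta_{0,j}$ counts minimal generators of degree $j$). A nonzero monomial ideal $I$ is $r$-step linear if it is generated in a single degree $d$ and $\beta_{i,j}(I)=0$ for all $(i,j)$ with $0\le i\le r$ and $j-i>d$; the Green-Lazarsfeld index is $\mathrm{index}(I)=\sup\{r: I\text{ is }r\text{-step linear}\}+1$ (possibly $\infty$). $I$ is linearly presented if $\mathrm{index}(I)>1$. *)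

(* Defs.v *)
From HB Require Import structures.
From mathcomp Require Import all_boot all_order all_algebra.
From mathcomp Require Import mpoly.
From Stdlib Require Import Classical ClassicalEpsilon.

Set Implicit Arguments.
Unset Strict Implicit.
Unset Printing Implicit Defensive.

Import GRing.Theory.

(* Clutters. The vertex set of a clutter D is the union [cover D] of its
   circuits; the ambient finite type may be larger. *)

Section Clutters.

Variable V : finType.
Implicit Types (C : {set {set V}}) (W : {set V}).

Definition uniform3 C : Prop := forall F : {set V}, F \in C -> #|F| = 3.

Definition clutter_compl C : {set {set V}} :=
  [set F : {set V} | (#|F| == 3) && (F \notin C)].

Definition induced C W : {set {set V}} := [set F in C | F \subset W].

End Clutters.

Definition has_induced_copy (V T : finType)
    (C : {set {set V}}) (D : {set {set T}}) : Prop :=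
  exists (W : {set V}) (f : V -> T),
    [/\ {in W &, injective f},
        f @: W = cover D
      & [set f @: F | F : {set V} in induced C W] = D].

Definition clutter_free (V T : finType)
    (Fam : {set {set {set T}}}) (C : {set {set V}}) : Prop :=
  forall D : {set {set T}}, D \in Fam -> ~ has_induced_copy C D.

(* The forbidden clutters live in 'I_7 so that vertices keep the labels
   1, ..., 6; the label 0 lies in no circuit, hence in no vertex set. *)

Definition tri (a b c : nat) : {set 'I_7} := [set inord a; inord b; inord c].

Definition clB : {set {set 'I_7}} :=
  [set tri 1 2 3; tri 1 2 4; tri 1 3 4; tri 2 3 5; tri 2 4 5; tri 3 4 5].
Definition clB1 : {set {set 'I_7}} := clB :|: [set tri 1 2 5].
Definition clB2 : {set {set 'I_7}} := clB :|: [set tri 1 2 5; tri 1 3 5].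
Definition clB' : {set {set 'I_7}} :=
  [set F : {set 'I_7} | (#|F| == 3) && (ord0 \notin F)]
    :\: [set tri 1 2 3; tri 4 5 6].

Definition famC : {set {set {set 'I_7}}} := [set clB; clB1; clB2; clB'].

Local Open Scope ring_scope.

(* [has_quot_dim Z B k]: for subspaces B <= Z of V, dim (Z / B) = k, witnessed
   by a family of k elements of Z that is a basis modulo B. *)
Definition has_quot_dim (K : fieldType) (V : lmodType K)
    (Z B : V -> Prop) (k : nat) : Prop :=
  exists z : 'I_k -> V,
    [/\ forall a, Z (z a),
        forall c : 'I_k -> K, B (\sum_a c a *: z a) -> forall a, c a = 0
      & forall y, Z y -> exists c : 'I_k -> K, B (y - \sum_a c a *: z a)].

Section Ideals.

Variables (K : fieldType) (n : nat).
Local Notation S := {mpoly K[n]}.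
Implicit Types I : S -> Prop.

Definition ideal_gen (G : S -> Prop) : S -> Prop :=
  fun p => exists (k : nat) (a g : 'I_k -> S),
    (forall l, G (g l)) /\ p = \sum_l a l * g l.

Definition edge_ideal (C : {set {set 'I_n}}) : S -> Prop :=
  ideal_gen (fun q => exists2 F : {set 'I_n}, F \in C & q = \prod_(v in F) 'X_v).

(* Tor^S_i(K, I)_j is the homology of (P_* (x) I)_j for the Koszul resolution
   P_* of K on x_1, ..., x_n: P_i is free on the e_T with #|T| = i, e_T has
   degree i, and
     d e_T = \sum_(v in T) (-1)^#|{u in T | u < v}| x_v e_(T :\ v).
   An element \sum_T e_T (x) c_T of P_* (x) I is the function c : T |-> c_T. *)

Local Notation koszul := {ffun {set 'I_n} -> S}.

Definition ksign (v : 'I_n) (T : {set 'I_n}) : K :=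
  (-1) ^+ #|[set u in T | (u < v)%N]|.

Definition koszul_d (c : koszul) : koszul :=
  [ffun T : {set 'I_n} => \sum_(v | v \notin T) ksign v T *: ('X_v * c (v |: T))].

(* The degree j component of P_i (x) I. *)
Definition koszul_chain I (i j : nat) (c : koszul) : Prop :=
  forall T : {set 'I_n},
    [/\ I (c T),
        #|T| <> i -> c T = 0
      & forall m, m \in msupp (c T) -> (i + mdeg m)%N = j].

Definition koszul_cycle I (i j : nat) (c : koszul) : Prop :=
  koszul_chain I i j c /\ koszul_d c = 0.

Definition koszul_boundary I (i j : nat) (c : koszul) : Prop :=
  exists2 b : koszul, koszul_chain I i.+1 j b & c = koszul_d b.

(* [is_betti I i j b]: beta_(i,j)(I) = dim_K Tor^S_i(K, I)_j = b. *)
Definition is_betti I (i j b : nat) : Prop :=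
  has_quot_dim (koszul_cycle I i j) (koszul_boundary I i j) b.

Definition generated_in_degree I (d : nat) : Prop :=
  forall p, I p <-> ideal_gen (fun q => I q /\ q \is d.-homog) p.

Definition step_linear (r : nat) I : Prop :=
  exists2 d : nat, generated_in_degree I d
    & forall i j : nat, (i <= r)%N -> (d + i < j)%N -> is_betti I i j 0.

(* P_* is a complex ([koszul_dd]) and a free resolution of K
   ([koszul_resolution]: the homology of P_* = P_* (x) S is K in homological
   degree 0 and internal degree 0, and zero elsewhere). *)

Lemma ksign_add (v w : 'I_n) (T : {set 'I_n}) :
  w != v -> w \notin T -> ksign v (w |: T) = (-1) ^+ (w < v)%N * ksign v T.
Proof.
move=> nwv wT; rewrite /ksign -exprD; congr (_ ^+ _).
case: ltnP => wv.
  rewrite [in LHS](_ : finset _ = w |: [set u in T | (u < v)%N]); last first.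
    by apply/setP=> u; rewrite !inE; case: eqP => [->|//]; rewrite wv.
  by rewrite cardsU1 !inE (negbTE wT).
congr #|pred_of_set _|; apply/setP=> u; rewrite !inE; case: eqP => [->|//].
by rewrite ltnNge wv (negbTE wT).
Qed.

Lemma koszul_dd (c : koszul) : koszul_d (koszul_d c) = 0.
Proof.
apply/ffunP=> T; rewrite !ffunE.
pose F v w : S := (ksign v T * ksign w (v |: T)) *: ('X_v * 'X_w * c (w |: (v |: T))).
have FN v w : v \notin T -> w \notin T -> v != w -> F w v = - F v w.
  move=> vT wT vw; rewrite /F.
  have wv : w != v by rewrite eq_sym.
  rewrite (ksign_add wv wT) (ksign_add vw vT).
  rewrite [v |: _]setUCA ['X_w * _]mulrC -scaleNr; congr (_ *: _).
  rewrite mulrCA [in RHS]mulrCA -mulrN mulrC.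
  case: (ltngtP v w) vw => [||/val_inj->]; rewrite ?eqxx // => _ _.
    by rewrite expr0 expr1 mulr1 mulN1r opprK mulrC.
  by rewrite expr0 expr1 mul1r mulrN1 mulrC.
pose sh (v w : 'I_n) := [&& v \notin T, w \notin T & (v < w)%N].
transitivity (\sum_(v | v \notin T) \sum_(w | (w \notin T) && (w != v)) F v w).
  apply: eq_bigr => v vT; rewrite ffunE mulr_sumr scaler_sumr.
  apply: eq_big => w; first by rewrite !inE negb_or andbC.
  by move=> _; rewrite /F -scalerAr scalerA mulrA.
transitivity (\sum_v \sum_(w | sh v w) F v w + \sum_v \sum_(w | sh w v) F v w).
  rewrite big_mkcond -big_split; apply: eq_bigr => v _ /=.
  case: ifP => vT; last first.
    by rewrite !big1 ?addr0 // => w; rewrite /sh vT ?andbF.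
  rewrite (bigID (fun w : 'I_n => (v < w)%N)) /=; congr (_ + _);
    apply: eq_bigl => w; rewrite /sh vT;
    rewrite (_ : (w != v) = (w != v :> nat)) //;
    by case: (ltngtP v w); rewrite ?andbF ?andbT.
rewrite [X in _ + X](exchange_big_dep predT) //= -big_split big1 // => v _.
rewrite /= -big_split big1 // => w /and3P[vT wT vw] /=.
rewrite (FN v w) ?addrN //.
by apply: contraTneq vw => ->; rewrite ltnn.
Qed.

Lemma mcoeff_mulXU (v : 'I_n) (q : S) m :
  ('X_v * q)@_m = if (0 < m v)%N then q@_(m - U_(v))%MM else 0.
Proof.
rewrite mulrC; case: ifPn => [mv|]; last first.
  move=> mv; apply/eqP; rewrite mcoeff_eq0 (perm_mem (msuppMX _ _)).
  apply: contra mv => /mapP[m' _ ->].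
  by rewrite mnmDE mnm1E eqxx.
have {1}-> : m = (U_(v) + (m - U_(v)))%MM; last by rewrite mcoeffMX.
apply/mnmP=> u; rewrite mnmDE mnmBE mnm1E.
by case: eqP => [<-|_]; rewrite ?subnKC // subn0 add0n.
Qed.

Lemma koszul_resolution (i j : nat) :
  is_betti (fun=> True) i j ((i == 0) && (j == 0))%N.
Proof.
case: andP => [[/eqP-> /eqP->]|ij0].
  exists (fun=> [ffun T : {set 'I_n} => (T == set0)%:R]); split.
  - move=> _; split; last first.
      apply/ffunP=> T; rewrite !ffunE big1 // => v _; rewrite ffunE.
      rewrite (_ : v |: T == set0 = false) ?mulr0 ?scaler0 //.
      by apply/eqP=> /setP/(_ v); rewrite !inE eqxx.
    move=> T; rewrite ffunE; split=> // [|m].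
      by case: eqP => // ->; rewrite cards0.
    by case: eqP => _; rewrite ?msupp0 // msupp1 inE => /eqP->; rewrite mdeg0.
  - move=> a; rewrite big_ord1 => -[b bch] /ffunP/(_ set0).
    rewrite !ffunE eqxx => /(congr1 (mcoeff 0%MM)); rewrite mcoeffZ mcoeff1 eqxx.
    rewrite mulr1 => a0 l; rewrite (ord1 l) a0 raddf_sum big1 // => v _ /=.
    by rewrite mcoeffZ mcoeff_mulXU mnm0E mulr0.
  - move=> y [ych _]; exists (fun=> (y set0)@_0%MM); exists 0.
      by move=> T; rewrite ffunE; split=> // m; rewrite msupp0.
    rewrite big_ord1; apply/ffunP=> T; rewrite !ffunE.
    rewrite big1 ?ffunE => [|v _]; last by rewrite ffunE mulr0 scaler0.
    have [_ yT ydeg] := ych T; have [->|/eqP TN0] := eqVneq; last first.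
      by rewrite yT ?scaler0 ?subr0 // => /eqP; rewrite cards_eq0 => /eqP.
    apply/mpolyP=> m; rewrite mcoeffB mcoeffZ mcoeff1 mcoeff0.
    have [->|m0] := eqVneq m 0%MM; first by rewrite mulr1 subrr.
    rewrite mulr0 subr0; apply/eqP; rewrite mcoeff_eq0; apply/negP=> my.
    have [_ _ /(_ m my)] := ych set0; rewrite add0n => /eqP.
    by rewrite mdeg_eq0 (negbTE m0).
exists (fun=> 0); split=> [[]//|c _ []//|c [cch c0]]; exists (fun=> 0).
rewrite big_ord0 subr0.
have cdeg T m : (c T)@_m != 0 -> #|T| = i /\ (i + mdeg m)%N = j.
  have [_ cT cdT] := cch T; rewrite -mcoeff_msupp => mc; split; last exact: cdT.
  by apply: NNPP => /cT c0T; rewrite c0T msupp0 in mc.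
pose E (T : {set 'I_n}) (m : 'X_{1..n}) (p : 'I_n) :=
  ((p \in T) || (0 < m p)%N) &&
    [forall u, ((u \in T) || (0 < m u)%N) ==> (p <= u)%N].
have Euniq T m p q : E T m p -> E T m q -> p = q.
  move=> /andP[p1 /forallP p2] /andP[q1 /forallP q2]; apply/val_inj/anti_leq.
  by rewrite (implyP (p2 q)) // (implyP (q2 p)).
pose f (T : {set 'I_n}) m := \sum_(p in T | E T m p) (c (T :\ p))@_(m + U_(p))%MM.
have fdeg T m : f T m != 0 -> #|T| = i.+1 /\ (i.+1 + mdeg m)%N = j.
  move=> fN0; have [p /andP[pT _]] : exists2 p, (p \in T) && E T m p
      & (c (T :\ p))@_(m + U_(p))%MM != 0.
    apply: NNPP => nex; case/negP: fN0; apply/eqP/big1 => p pP.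
    by apply/eqP/negPn/negP=> ?; apply: nex; exists p.
  by move=> /cdeg; rewrite (cardsD1 p T) pT mdegD mdeg1 addn1 addnS => -[-> <-].
pose b : koszul :=
  [ffun T : {set 'I_n} => \sum_(m : 'X_{1..n < j.+1}) (f T m *: 'X_[m])].
have bE T m : (b T)@_m = f T m.
  rewrite ffunE; have [mj|jm] := ltnP (mdeg m) j.+1; first by rewrite mcoeff_mpoly.
  rewrite (_ : f T m = 0); last first.
    apply/eqP/negPn/negP=> /fdeg[_ jE]; move: jm.
    by rewrite -jE ltnNge leq_addl.
  rewrite raddf_sum big1 // => -[m' /= m'j] _; rewrite mcoeffZ mcoeffX.
  by case: eqP => [mm|]; rewrite ?mulr0 //; rewrite -mm ltnNge -ltnS m'j in jm.
exists b.
  move=> T; split=> // [TN|m]; last by rewrite mcoeff_msupp bE => /fdeg[].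
  by apply/mpolyP=> m; rewrite bE mcoeff0; apply/eqP/negPn/negP=> /fdeg[].
apply/ffunP=> T; apply/mpolyP=> m; rewrite ffunE raddf_sum /=.
have signl (p : 'I_n) (A : {set 'I_n}) :
    (forall u, u \in A -> (p <= u)%N) -> ksign p A = 1.
  move=> pA; rewrite /ksign (_ : finset _ = set0) ?cards0 //.
  by apply/setP=> u; rewrite !inE ltnNge; apply/negP=> /andP[/pA->].
have mE (v p : 'I_n) : (0 < m v)%N ->
    (m - U_(v) + U_(p))%MM = (m + U_(p) - U_(v))%MM.
  move=> mv; apply/mnmP=> u; rewrite !(mnmBE, mnmDE) !mnm1E addnBAC //.
  by case: eqP => [<-|].
have [p Ep|noE] := pickP (E T m); last first.
  have zero u : (u \in T) || (0 < m u)%N -> False.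
    pose P u := (u \in T) || (0 < m u)%N.
    move=> uP; case: (arg_minnP (P := P) (fun u : 'I_n => val u) uP) => p pP pmin.
    have := noE p; rewrite /E -/(P p) pP /= => /negbT/forallP[] w.
    apply/implyP; exact: pmin.
  have T0 : T = set0 by apply/setP=> u; rewrite inE; apply/negP=> uT; case: (zero u); rewrite uT.
  have m0 : m = 0%MM.
    apply/mnmP=> u; rewrite mnm0E; apply/eqP; rewrite -leqn0 leqNgt.
    by apply/negP=> mu; case: (zero u); rewrite mu orbT.
  rewrite big1 => [|v _].
    apply/eqP/negPn/negP=> /cdeg[]; rewrite T0 m0 cards0 mdeg0 => i0 j0.
    by apply: ij0; rewrite -j0 -i0.
  by rewrite mcoeffZ mcoeff_mulXU m0 mnm0E mulr0.
have pmin u : (u \in T) || (0 < m u)%N -> (p <= u)%N.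
  by move=> uP; have /andP[_ /forallP/(_ u)/implyP] := Ep; apply.
have Ev v : v \notin T -> (0 < m v)%N -> p \in v |: T ->
    f (v |: T) (m - U_(v))%MM = (c ((v |: T) :\ p))@_(m + U_(p) - U_(v))%MM.
  move=> vT mv pvT; rewrite /f.
  have Evp : E (v |: T) (m - U_(v))%MM p.
    rewrite /E pvT /=; apply/forallP=> u; apply/implyP=> uP; apply: pmin.
    move: uP; rewrite !inE mnmBE mnm1E; case: eqP => [->|/eqP/negbTE uv].
      by rewrite mv orbT.
    by rewrite eq_sym uv subn0.
  rewrite (bigD1 p) ?pvT //= big1 ?addr0 ?mE // => q /andP[/andP[_ Eq]].
  by rewrite (Euniq _ _ _ _ Eq Evp) eqxx.
have Ev0 v : v \notin T -> (0 < m v)%N -> p \notin v |: T ->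
    f (v |: T) (m - U_(v))%MM = 0.
  move=> vT mv pvT; rewrite /f big1 // => q /andP[qvT].
  move=> /andP[_ /forallP/(_ p)/implyP qp]; case/negP: pvT.
  have /andP[pP _] := Ep.
  have [->|pv] := eqVneq p v; first by rewrite !inE eqxx.
  have pq : (p <= q)%N.
    by apply: pmin; move: qvT; rewrite !inE => /orP[/eqP->|->]//; rewrite mv orbT.
  rewrite (_ : p = q) //; apply/val_inj/anti_leq; rewrite pq qp //.
  by rewrite !inE mnmBE mnm1E [v == p]eq_sym (negbTE pv) subn0.
have [pT|pT] := boolP (p \in T); last first.
  have mp : (0 < m p)%N by have := Ep; rewrite /E (negbTE pT) => /andP[].
  rewrite (bigD1 p) //= big1 ?addr0 => [|v /andP[vT vp]]; last first.
    rewrite mcoeffZ mcoeff_mulXU; case: ifP => mv; last by rewrite mulr0.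
    by rewrite bE Ev0 ?mulr0 // !inE negb_or pT eq_sym vp.
  rewrite mcoeffZ mcoeff_mulXU mp bE Ev ?setU11 // setU1K // addmK.
  by rewrite signl ?mul1r // => u uT; apply: pmin; rewrite uT.
move: c0 => /ffunP/(_ (T :\ p)); rewrite !ffunE => /(congr1 (mcoeff (m + U_(p))%MM)).
rewrite raddf_sum (bigD1 p) ?setD11 //= mcoeff0 mcoeffZ mcoeff_mulXU.
rewrite mnmDE mnm1E eqxx addn1 /= addmK setD1K // signl; last first.
  by move=> u /setD1P[_ uT]; apply: pmin; rewrite uT.
rewrite mul1r => /eqP; rewrite addr_eq0 => /eqP->; rewrite -sumrN.
apply: eq_big => [v|v /andP[]].
  by rewrite !inE negb_and negbK; case: (eqVneq v p) => [->|]; rewrite ?pT ?andbT ?andbF.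
rewrite !inE negb_and negbK => /orP[/eqP->|vT]; first by rewrite eqxx.
move=> vp; rewrite !mcoeffZ !mcoeff_mulXU mnmDE mnm1E eq_sym (negbTE vp) addn0.
case: ifP => mv; last by rewrite !mulr0 oppr0.
rewrite bE Ev ?inE ?pT ?orbT // -mulNr; congr (_ * (c _)@__).
  rewrite -[in RHS](setD1K pT) ksign_add ?setD11 1?eq_sym //.
  have pv : (p < v)%N.
    by rewrite ltn_neqAle pmin ?mv ?orbT // andbT val_eqE eq_sym.
  by rewrite pv expr1 mulN1r.
apply/setP=> u; rewrite !inE; case: (eqVneq u v) => [->|] //=.
by rewrite vp.
Qed.

End Ideals.

Arguments edge_ideal K {n} C.

Inductive enat := Fin of nat | Infty.

Definition enat_le (x y : enat) : bool :=
  match x, y with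
  | _, Infty => true
  | Infty, Fin _ => false
  | Fin a, Fin b => (a <= b)%N
  end.

Definition enat_lt (x y : enat) : bool := ~~ enat_le y x.

Definition enat_succ (x : enat) : enat :=
  if x is Fin a then Fin a.+1 else Infty.

Definition is_enat_sup (A : nat -> Prop) (s : enat) : Prop :=
  (forall r, A r -> enat_le (Fin r) s) /\
  (forall u, (forall r, A r -> enat_le (Fin r) u) -> enat_le s u).

Lemma enat_sup_exists (A : nat -> Prop) : exists s, is_enat_sup A s.
Proof.
have [[N]|unb] := classic (exists N, forall r, A r -> (r <= N)%N); last first.
  exists Infty; split=> // -[b|//] ub; case: unb; exists b => r /ub.
  by rewrite /enat_le.
elim: N => [|N IH] ubN.
  by exists (Fin 0); split=> [r /ubN|[]].
have [AN|nAN] := classic (A N.+1).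
  by exists (Fin N.+1); split=> [r /ubN|u]; last exact.
apply: IH => r Ar; have := ubN _ Ar; rewrite leq_eqVlt ltnS => /orP[/eqP rE|//].
by case: nAN; rewrite -rE.
Qed.

Definition enat_sup (A : nat -> Prop) : enat :=
  proj1_sig (constructive_indefinite_description _ (enat_sup_exists A)).

Lemma enat_supP (A : nat -> Prop) : is_enat_sup A (enat_sup A).
Proof. exact: proj2_sig. Qed.

(* Meaningful for ideals generated in one degree, which are 0-step linear, so
   that the supremum is over a nonempty set. *)
Definition gl_index (K : fieldType) (n : nat) (I : {mpoly K[n]} -> Prop) : enat :=
  enat_succ (enat_sup (fun r => step_linear r I)).

(* Main.v *)
Require Import Defs.
From mathcomp Require Import all_boot all_order all_algebra.
From mathcomp Require Import mpoly.
From Stdlib Require Import Classical.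

Set Implicit Arguments.
Unset Strict Implicit.
Unset Printing Implicit Defensive.

(** The module Tor_1(K, I) is graded by monomials, and its part of multidegree
m is read off the Koszul complex. Let G_m be the graph whose vertices are
the variables v with m / x_v in I and whose edges are the pairs v, w with
m / (x_v x_w) in I. One-chains of multidegree m are combinations of vertices
of G_m, the cycles are those with coefficient sum 0, and the boundaries are
spanned by the differences of the ends of edges. So beta_(1,j)(I) = 0 exactly
when G_m is connected for every monomial m of degree j
([betti1_eq0_of_connected], [connected_of_betti1_eq0]).

For an edge ideal of triples, let v and w lie in different components of G_m.
Some circuit F survives in m / x_v and some circuit F' in m / x_w. If a
variable u still divided m after removing x_u for each u in the union of F
and F', it would be adjacent to v through F and to w through F'. Hence m is
the squarefree product over the union of F and F' ([disconnected_multidegree]).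
Its degree is at most 6, so that all beta_(1,j) with j > 6 vanish. Since I is
generated in degree 3, being linearly presented therefore means that beta_(1,5)
and beta_(1,6) vanish ([edge_step_linearP]).

In degree at least 5, the graph can thus be disconnected only for products of 5
or 6 distinct variables. For 6 variables the circuits F and F' are disjoint, and
any third circuit would join the triangle on F to the triangle on F'; so F and
F' are the only circuits, which means that the complement clutter induces a copy
of B'. For 5 variables each edge of G_m is the complement of a circuit, so G_m
splits into an edge {p, q} and a part of the triangle F opposite to it: no
circuit consists of one of p, q and two vertices of F. The complement clutter
then contains all six faces of the bipyramid over F with apexes p and q. Besides
F, at least one of the triples p q x with x in F is a circuit, and according to
whether there are three, two or one of them the complement clutter induces B, B1
or B2 ([koszul_connected5], [copy_of_split_bipyramid]). These steps can all be
reversed. *)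

(** * The first Betti numbers of a monomial ideal *)

Section MonomialIdeals.
Import GRing.Theory.
Local Open Scope ring_scope.

Variables (K : fieldType) (n : nat).
Local Notation S := {mpoly K[n]}.
Local Notation koszul := {ffun {set 'I_n} -> S}.

Lemma is_betti0E (I : S -> Prop) i j :
  is_betti I i j 0 <->
  forall c, koszul_cycle I i j c -> koszul_boundary I i j c.
Proof.
split=> [[z [_ _ zB]] c /zB[a]|cB]; first by rewrite big_ord0 subr0.
exists (fun=> 0); split=> [[]//|c _ []//|c /cB cb].
by exists (fun=> 0); rewrite big_ord0 subr0.
Qed.

Lemma koszul_d_linear a (b c : koszul) :
  koszul_d (a *: b + c) = a *: koszul_d b + koszul_d c.
Proof.
apply/ffunP=> T; rewrite !ffunE scaler_sumr -big_split; apply: eq_bigr => v _ /=.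
by rewrite !ffunE mulrDr -scalerAr scalerDr !scalerA mulrC.
Qed.

Lemma koszul_d0 : koszul_d (0 : koszul) = 0.
Proof.
by apply/ffunP=> T; rewrite !ffunE big1 // => v _; rewrite ffunE mulr0 scaler0.
Qed.

Lemma koszul_dZ a (c : koszul) : koszul_d (a *: c) = a *: koszul_d c.
Proof. by rewrite -[a *: c]addr0 koszul_d_linear koszul_d0 addr0. Qed.

Lemma koszul_dB (b c : koszul) : koszul_d (b - c) = koszul_d b - koszul_d c.
Proof. by rewrite addrC -scaleN1r koszul_d_linear scaleN1r addrC. Qed.

Lemma ksign1 (v w : 'I_n) : ksign K v [set w] = (-1) ^+ (w < v)%N.
Proof.
rewrite /ksign; congr (_ ^+ _); case: ltnP => wv.
  rewrite (_ : finset _ = [set w]) ?cards1 //; apply/setP=> u; rewrite !inE.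
  by case: eqP => // ->.
rewrite (_ : finset _ = set0) ?cards0 //; apply/setP=> u; rewrite !inE.
by case: eqP => // ->; rewrite ltnNge wv.
Qed.

Lemma ksign_set0 (v : 'I_n) : ksign K v set0 = 1.
Proof.
by rewrite /ksign (_ : finset _ = set0) ?cards0 //; apply/setP=> u; rewrite !inE.
Qed.

Lemma mcoeff_koszul_d0 (c : koszul) (m : 'X_{1..n}) :
  (koszul_d c set0)@_m
  = \sum_(v | (0 < m v)%N) (c [set v])@_(m - U_(v))%MM.
Proof.
rewrite ffunE raddf_sum [RHS]big_mkcond; apply: eq_big => [v|v _]; first by rewrite inE.
by rewrite /= ksign_set0 scale1r mcoeff_mulXU setU0.
Qed.

Lemma ksign1_opp (v w : 'I_n) :
  v != w -> ksign K v [set w] * ksign K w [set v] = -1.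
Proof.
rewrite -val_eqE !ksign1; case: ltngtP => //= _ _; by rewrite ?mulr1 ?mul1r expr1.
Qed.

(** The basis element 'X_[m] e_T of the Koszul complex. *)
Definition koszul_mon (T : {set 'I_n}) (m : 'X_{1..n}) : koszul :=
  [ffun U : {set 'I_n} => (U == T)%:R *: 'X_[m]].

Lemma mcoeff_koszul_mon (T : {set _}) m U m' :
  (koszul_mon T m U)@_m' = ((U == T) && (m == m'))%:R.
Proof. by rewrite ffunE mcoeffZ mcoeffX -natrM mulnb. Qed.

Lemma koszul_d_mon U m :
  koszul_d (koszul_mon U m)
  = \sum_(u in U) ksign K u (U :\ u) *: koszul_mon (U :\ u) (m + U_(u))%MM.
Proof.
apply/ffunP=> T; rewrite ffunE sum_ffunE big_mkcond [RHS]big_mkcond /=.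
apply: eq_bigr => u _; rewrite !ffunE.
have [uT|uT] /= := boolP (u \in T).
  case: ifP => // uU; rewrite (_ : T == _ = false) ?scale0r ?scaler0 //.
  by apply/eqP=> E; rewrite E !inE eqxx in uT.
have [<-|UT] := eqVneq.
  by rewrite setU11 setU1K // eqxx !scale1r mulrC mpolyXD.
rewrite scale0r mulr0 scaler0; case: ifP => // uU; rewrite (_ : T == _ = false).
  by rewrite scale0r scaler0.
by apply: contraNF UT => /eqP->; rewrite setD1K.
Qed.

Lemma koszul_d_vertex (v : 'I_n) m :
  koszul_d (koszul_mon [set v] m) = koszul_mon set0 (m + U_(v))%MM.
Proof.
by rewrite koszul_d_mon big_set1 setDv ksign_set0 scale1r.
Qed.

Lemma koszul_d_edge (v w : 'I_n) m : v != w ->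
  koszul_d (ksign K w [set v] *: koszul_mon [set v; w] m)
  = koszul_mon [set v] (m + U_(w))%MM - koszul_mon [set w] (m + U_(v))%MM.
Proof.
move=> vw; rewrite koszul_dZ koszul_d_mon big_setU1 ?inE //= big_set1.
rewrite setU1K ?inE // setUC setU1K ?inE 1?eq_sym // scalerDr !scalerA.
rewrite [_ * ksign K v _]mulrC ksign1_opp // ksign1 -expr2 sqrr_sign.
by rewrite scale1r scaleN1r addrC.
Qed.

(** A monomial ideal is given by the set P of its monomials; only the part of
the Koszul complex in homological degrees 0, 1, 2 is used. *)

Section Betti1.

Variables (I : S -> Prop) (P : pred 'X_{1..n}).
Hypothesis IP : forall p, I p <-> {in msupp p, forall m, P m}.

(** [koszul_vertex] and [koszul_edge] describe the 1-skeleton of the upper Koszul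
simplicial complex of the ideal in multidegree m. *)
Definition koszul_vertex (m : 'X_{1..n}) (v : 'I_n) : bool :=
  (0 < m v)%N && P (m - U_(v))%MM.

Definition koszul_edge (m : 'X_{1..n}) (v w : 'I_n) : bool :=
  [&& v != w, (0 < m v)%N, (0 < m w)%N & P (m - U_(v) - U_(w))%MM].

Definition koszul_connected (j : nat) : Prop :=
  forall m, mdeg m = j ->
  {in koszul_vertex m &, forall v w, connect (koszul_edge m) v w}.

Lemma monomial_ideal_lin a p q : I p -> I q -> I (a *: p + q).
Proof.
move=> /IP Ip /IP Iq; apply/IP=> m /msuppD_le; rewrite mem_cat.
by case/orP=> [/msuppZ_le|]; [apply: Ip | apply: Iq].
Qed.

Lemma monomial_ideal0 : I 0.
Proof. by apply/IP=> m; rewrite msupp0. Qed.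

Lemma koszul_boundary_lin i j a (b c : koszul) :
  koszul_boundary I i j b -> koszul_boundary I i j c ->
  koszul_boundary I i j (a *: b + c).
Proof.
move=> [b' bch ->] [c' cch ->]; exists (a *: b' + c'); last first.
  by rewrite koszul_d_linear.
move=> T; have [bI b0 bd] := bch T; have [cI c0 cd] := cch T.
rewrite !ffunE; split; first exact: monomial_ideal_lin.
  by move=> Ti; rewrite b0 // c0 // scaler0 addr0.
by move=> m /msuppD_le; rewrite mem_cat => /orP[/msuppZ_le/bd|/cd].
Qed.

Lemma koszul_boundary0 i j : koszul_boundary I i j 0.
Proof.
exists 0; last by rewrite koszul_d0.
move=> T; rewrite ffunE; split=> // [|m]; first exact: monomial_ideal0.
by rewrite msupp0.
Qed.

Lemma koszul_boundary_sum i j (A : Type) (r : seq A) (Q : pred A) (F : A -> koszul) :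
  (forall x, Q x -> koszul_boundary I i j (F x)) ->
  koszul_boundary I i j (\sum_(x <- r | Q x) F x).
Proof.
move=> FB; apply: big_ind => // [|b c bB cB]; first exact: koszul_boundary0.
by rewrite -[b]scale1r; apply: koszul_boundary_lin.
Qed.

Lemma mnm_sub_addC (m : 'X_{1..n}) (v w : 'I_n) :
  v != w -> (0 < m v)%N -> (m - U_(v) - U_(w) + U_(v))%MM = (m - U_(w))%MM.
Proof.
move=> vw mv; apply/mnmP=> u; rewrite mnmDE !mnmBE !mnm1E.
case: (eqVneq v u) => [<-|_]; last by rewrite subn0 addn0.
by rewrite eq_sym (negbTE vw) !subn0 subnK.
Qed.

Lemma mnm_subK (m : 'X_{1..n}) (v : 'I_n) :
  (0 < m v)%N -> (m - U_(v) + U_(v))%MM = m.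
Proof.
move=> mv; apply/mnmP=> u; rewrite mnmDE mnmBE mnm1E.
by case: (eqVneq v u) => [<-|_]; rewrite ?subnK ?subn0 ?addn0.
Qed.

Lemma mnm_subC (m k l : 'X_{1..n}) : (m - k - l = m - l - k)%MM.
Proof. by apply/mnmP=> u; rewrite !mnmBE subnAC. Qed.

(** The edge {v, w} is itself a 2-chain of multidegree m, and its boundary is the
difference of its ends up to sign. *)
Lemma edge_koszul_boundary m j v w : mdeg m = j -> koszul_edge m v w ->
  koszul_boundary I 1 j
    (koszul_mon [set v] (m - U_(v))%MM - koszul_mon [set w] (m - U_(w))%MM).
Proof.
move=> mj /and4P[vw mv mw Pm].
exists (ksign K w [set v] *: koszul_mon [set v; w] (m - U_(v) - U_(w))%MM).
  have supp T m' : m' \in msupp (koszul_mon [set v; w] (m - U_(v) - U_(w))%MM T) ->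
      T = [set v; w] /\ m' = (m - U_(v) - U_(w))%MM.
    rewrite mcoeff_msupp mcoeff_koszul_mon.
    by case: (T =P _); case: (_ =P m'); rewrite ?eqxx.
  move=> T; rewrite ffunE; split.
  - by apply/IP=> m' /msuppZ_le/supp[_ ->].
  - move=> T2; rewrite ffunE; case: eqP => [TE|_]; last by rewrite scale0r scaler0.
    by case: T2; rewrite TE cards2 vw.
  - move=> m' /msuppZ_le/supp[_ ->]; rewrite -mj -[in RHS](mnm_subK mw).
    by rewrite -(mnm_sub_addC vw mv) !mdegD !mdeg1 !addn1.
rewrite koszul_d_edge // mnm_sub_addC //; congr (koszul_mon _ _ - _).
by rewrite mnm_subC mnm_sub_addC // eq_sym.
Qed.


Lemma connect_koszul_boundary m j v w : mdeg m = j -> connect (koszul_edge m) v w ->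
  koszul_boundary I 1 j
    (koszul_mon [set v] (m - U_(v))%MM - koszul_mon [set w] (m - U_(w))%MM).
Proof.
move=> mj /connectP[p]; elim: p v => [|u p IHp] v /=.
  by move=> _ ->; rewrite subrr; apply: koszul_boundary0.
move=> /andP[vu up] wE; rewrite -(subrKA (koszul_mon [set u] (m - U_(u))%MM)).
rewrite -[X in X + _]scale1r; apply: koszul_boundary_lin.
  exact: edge_koszul_boundary.
exact: IHp.
Qed.

(** Each multidegree is treated separately: the coefficients of a cycle there sum
to 0, so the cycle is a combination of differences v - r with a fixed vertex r,
and such a difference is a boundary when r and v are connected. *)
Lemma betti1_eq0_of_connected j : koszul_connected j -> is_betti I 1 j 0.
Proof.
move=> conn; apply/is_betti0E => c [cch /ffunP/(_ set0) c0].
have cdeg T m : (c T)@_m != 0 -> [/\ #|T| = 1%N, P m & (1 + mdeg m)%N = j].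
  have [/IP cI cT cdT] := cch T; rewrite -mcoeff_msupp => mc; split.
  - by apply: NNPP => /cT c0T; rewrite c0T msupp0 in mc.
  - exact: cI.
  - exact: cdT.
(* The coefficient of the vertex v in the part of c of multidegree m. *)
pose a (m : 'X_{1..n}) (v : 'I_n) :=
  if (0 < m v)%N then (c [set v])@_(m - U_(v))%MM else 0.
have asum m : \sum_v a m v = 0.
  move: c0 => /(congr1 (mcoeff m)); rewrite mcoeff_koszul_d0 ffunE mcoeff0 => c0.
  by rewrite -[RHS]c0 [RHS]big_mkcond.
pose cm m := \sum_v a m v *: koszul_mon [set v] (m - U_(v))%MM.
have -> : c = \sum_(m : 'X_{1..n < j.+1}) cm m.
  apply/ffunP=> T; apply/mpolyP=> m'; rewrite sum_ffunE raddf_sum /=.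
  have cmE m : (cm m T)@_m' =
      \sum_v a m v * ((T == [set v]) && ((m - U_(v))%MM == m'))%:R.
    rewrite sum_ffunE raddf_sum; apply: eq_bigr => v _ /=.
    by rewrite ffunE mcoeffZ mcoeff_koszul_mon.
  under eq_bigr do rewrite cmE.
  have [/eqP/cards1P[v TE]|T1] := eqVneq #|T| 1%N; last first.
    rewrite big1 => [|m _].
      by apply/eqP/negPn/negP=> /cdeg[/eqP]; rewrite (negbTE T1).
    rewrite big1 // => v _; case: eqP => [TE|_]; last by rewrite mulr0.
    by rewrite TE cards1 in T1.
  rewrite exchange_big (bigD1 v) //= [X in _ + X]big1 ?addr0; last first.
    move=> u uv; rewrite big1 // => m _.
    by rewrite TE (inj_eq set1_inj) eq_sym (negbTE uv) mulr0.
  have aE (m : 'X_{1..n < j.+1}) : val m != (m' + U_(v))%MM ->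
      a m v * ((T == [set v]) && ((m - U_(v))%MM == m'))%:R = 0.
    move=> mm; rewrite /a; case: ifP => mv; last by rewrite mul0r.
    case: (_ =P m') => [mE|]; last by rewrite andbF mulr0.
    by case/eqP: mm; rewrite -mE mnm_subK.
  have [m'j|jm'] := ltnP (mdeg (m' + U_(v))) j.+1.
    rewrite (bigD1 (BMultinom m'j)) //= big1 ?addr0 => [|m mm]; last exact: aE.
    by rewrite /a mnmDE mnm1E eqxx addn1 /= addmK TE !eqxx mulr1.
  rewrite big1 => [|m _].
    apply/eqP/negPn/negP=> /cdeg[_ _ jE].
    by move: jm'; rewrite mdegD mdeg1 addnC jE ltnn.
  by apply: aE; apply: contraTneq jm' => <-; rewrite -leqNgt -ltnS bmdeg.
apply: koszul_boundary_sum => -[m /= _] _.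
have [r ar|a0] := pickP (fun v => a m v != 0); last first.
  rewrite /cm big1 => [|v _]; first exact: koszul_boundary0.
  by have /negbFE/eqP-> := a0 v; rewrite scale0r.
have avert v : a m v != 0 -> mdeg m = j /\ koszul_vertex m v.
  rewrite /a /koszul_vertex; case: ifP => [mv|]; last by rewrite eqxx.
  by move=> /cdeg[_ -> <-]; split=> //; rewrite -[in LHS](mnm_subK mv) mdegD mdeg1 addnC.
have -> : cm m = \sum_v a m v *: (koszul_mon [set v] (m - U_(v))%MM
                                 - koszul_mon [set r] (m - U_(r))%MM).
  under [RHS]eq_bigr do rewrite scalerBr.
  by rewrite sumrB -scaler_suml asum scale0r subr0.
apply: koszul_boundary_sum => v _; have [->|av] := eqVneq (a m v) 0.
  by rewrite scale0r; apply: koszul_boundary0.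
have [mj rv] := avert r ar; have [_ vv] := avert v av.
rewrite -[X in koszul_boundary _ _ _ X]addr0.
apply: koszul_boundary_lin (koszul_boundary0 _ _).
exact/connect_koszul_boundary/conn.
Qed.

(** If v and w are not connected, the cycle v - w bounds no chain. Were it the
boundary of b, restricting b to the component A of v would not change the
coefficients of the boundary at vertices of A, and would kill the others. The
restricted chain b' would then have boundary v, contrary to d d b' = 0. *)
Lemma connected_of_betti1_eq0 j : is_betti I 1 j 0 -> koszul_connected j.
Proof.
move=> /is_betti0E cyB m mj v w vv wv; apply: contraTT isT => vw.
have [/andP[mv Pv] /andP[mw Pw]] := (vv, wv).
have vnw : v != w by apply: contraNneq vw => ->.
set z := koszul_mon [set v] (m - U_(v))%MM - koszul_mon [set w] (m - U_(w))%MM.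
have zcoef T m' : (z T)@_m' = ((T == [set v]) && ((m - U_(v))%MM == m'))%:R
                            - ((T == [set w]) && ((m - U_(w))%MM == m'))%:R.
  by rewrite !ffunE mcoeffB !mcoeffZ !mcoeffX -!natrM !mulnb.
have [b bch zE] : koszul_boundary I 1 j z.
  apply: cyB; split; last first.
    by rewrite koszul_dB !koszul_d_vertex !mnm_subK // subrr.
  have zsupp T m' : m' \in msupp (z T) ->
      exists2 u, koszul_vertex m u & T = [set u] /\ m' = (m - U_(u))%MM.
    rewrite mcoeff_msupp zcoef.
    case: andP => [[/eqP-> /eqP<-] _|_]; first by exists v.
    case: andP => [[/eqP-> /eqP<-] _|_]; first by exists w.
    by rewrite subrr eqxx.
  move=> T; split.
  - by apply/IP=> m' /zsupp[u /andP[_ Pu] [_ ->]].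
  - move=> T1; apply/eqP; rewrite -msupp_eq0.
    case E: (msupp (z T)) => [//|m' s].
    have [|u _ [TE _]] := zsupp T m'; first by rewrite E mem_head.
    by case: T1; rewrite TE cards1.
  - move=> m' /zsupp[u /andP[mu _] [_ ->]].
    by rewrite -mj -[in RHS](mnm_subK mu) mdegD mdeg1 addnC.
pose A : {set 'I_n} := [set u | connect (koszul_edge m) v u].
pose b' : koszul := [ffun T : {set 'I_n} => if T \subset A then b T else 0].
have b'out u : u \notin A -> koszul_d b' [set u] = 0.
  move=> uA; rewrite ffunE big1 // => x _; rewrite ffunE.
  by rewrite subUset !sub1set (negbTE uA) andbF mulr0 scaler0.
(* In multidegree m, a term of b that touches A but does not lie inside A would
   come from an edge leaving the component A. *)
have b'in u : (0 < m u)%N -> u \in A ->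
    (koszul_d b' [set u])@_(m - U_(u))%MM = (z [set u])@_(m - U_(u))%MM.
  move=> mu uA; rewrite zE !ffunE !raddf_sum; apply: eq_bigr => x xu /=.
  rewrite !mcoeffZ !mcoeff_mulXU; case: ifP => // mx; congr (_ * _).
  rewrite ffunE subUset !sub1set uA andbT; case: ifPn => // xA.
  rewrite mcoeff0; apply/esym/eqP; rewrite mcoeff_eq0; apply: contra xA => bx.
  have [/IP/(_ _ bx) Px _ _] := bch (x |: [set u]).
  rewrite inE in uA; rewrite inE; apply: connect_trans uA (connect1 _).
  rewrite /koszul_edge mu Px andbT /= eq_sym; rewrite inE in xu; rewrite xu.
  by apply: leq_trans mx _; rewrite mnmBE leq_subr.
have vA : v \in A by rewrite inE connect0.
have wA : w \notin A by rewrite inE.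
have /eqP := mcoeff_koszul_d0 (koszul_d b') m.
rewrite koszul_dd ffunE mcoeff0 (bigD1 v) //= big1 ?addr0 => [|u /andP[mu uv]].
  rewrite b'in // zcoef !eqxx (inj_eq set1_inj) (negbTE vnw).
  by rewrite subr0 eq_sym oner_eq0.
have [uA|/b'out->] := boolP (u \in A); last by rewrite mcoeff0.
have uw : u != w by apply: contraNneq wA => <-.
by rewrite b'in // zcoef !(inj_eq set1_inj) (negbTE uv) (negbTE uw) subrr.
Qed.

(** A generator of degree j would be a monomial of P that no variable divides
within P. *)
Lemma betti0_eq0 j :
  (forall m, P m -> mdeg m = j -> exists v, koszul_vertex m v) ->
  is_betti I 0 j 0.
Proof.
move=> Pj; apply/is_betti0E => c [cch _].
have [/IP cI _ cdeg] := cch set0.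
have -> : c = \sum_(m <- msupp (c set0)) (c set0)@_m *: koszul_mon set0 m.
  apply/ffunP=> T; rewrite sum_ffunE; have [->|TN0] := eqVneq T set0.
    rewrite [LHS]mpolyE; apply: eq_bigr => m _.
    by rewrite !ffunE eqxx scale1r.
  have [_ cT _] := cch T.
  rewrite cT; last by apply/eqP; rewrite cards_eq0.
  by rewrite big1 // => m _; rewrite !ffunE (negbTE TN0) scale0r scaler0.
rewrite big_seq; apply: koszul_boundary_sum => m mc.
rewrite -[X in koszul_boundary _ _ _ X]addr0.
apply: koszul_boundary_lin (koszul_boundary0 _ _).
have mj : mdeg m = j by rewrite -(cdeg m mc).
have [v /andP[mv Pv]] := Pj m (cI m mc) mj.
exists (koszul_mon [set v] (m - U_(v))%MM); last first.
  by rewrite koszul_d_vertex mnm_subK.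
have supp T m' : m' \in msupp (koszul_mon [set v] (m - U_(v))%MM T) ->
    T = [set v] /\ m' = (m - U_(v))%MM.
  rewrite mcoeff_msupp mcoeff_koszul_mon.
  by case: (T =P _); case: (_ =P m'); rewrite ?eqxx.
move=> T; split.
- by apply/IP=> m' /supp[_ ->].
- move=> T1; rewrite ffunE; case: eqP => [TE|_]; last by rewrite scale0r.
  by case: T1; rewrite TE cards1.
- by move=> m' /supp[_ ->]; rewrite -mj -[in RHS](mnm_subK mv) mdegD mdeg1 addnC.
Qed.

End Betti1.
End MonomialIdeals.

(** * Edge ideals of triples and the Green-Lazarsfeld index *)

Section EdgeIdeal.
Import GRing.Theory.
Local Open Scope ring_scope.

Variables (K : fieldType) (n : nat).
Local Notation S := {mpoly K[n]}.
Implicit Types (C : {set {set 'I_n}}) (m : 'X_{1..n}).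

Lemma mdeg_le m1 m2 : (m1 <= m2)%MM -> (mdeg m1 <= mdeg m2)%N.
Proof. by move=> le12; rewrite -(submK le12) mdegD leq_addl. Qed.

Lemma ideal_gen_mon (G : S -> Prop) (p : S) :
  {in msupp p, forall m, exists2 k, G 'X_[k] & (k <= m)%MM} -> ideal_gen G p.
Proof.
move=> Gp; pose t := tnth (in_tuple (msupp p)).
have /fin_all_exists2[k Gk km] : forall l, exists2 k, G 'X_[k] & (k <= t l)%MM.
  by move=> l; apply/Gp/mem_tnth.
exists (size (msupp p)), (fun l => p@_(t l) *: 'X_[t l - k l]), (fun l => 'X_[k l]).
split=> //; rewrite {1}[p]mpolyE big_tnth; apply: eq_bigr => l _.
by rewrite -scalerAl -mpolyXD submK.
Qed.

Lemma ideal_gen_msupp (G : S -> Prop) (p : S) : ideal_gen G p ->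
  {in msupp p, forall m, exists g k, [/\ G g, k \in msupp g & (k <= m)%MM]}.
Proof.
move=> [k [a [g [Gg ->]]]] m /msupp_sum_le/flatten_mapP[l _].
move=> /msuppM_le/allpairsP[[m1 m2] [/= _ gm2 ->]].
by exists (g l), m2; split=> //; apply: lem_addl.
Qed.

Definition has_circuit C m : bool := [exists F in C, (mesym1 F <= m)%MM].

Lemma prod_mesym1 (F : {set 'I_n}) : \prod_(v in F) 'X_v = 'X_[mesym1 F] :> S.
Proof.
rewrite mprodXE; congr 'X_[_]; apply/mnmP=> i; rewrite mnmE mnm_sumE big_mkcond /=.
rewrite (bigD1 i) //= mnmE eqxx /= big1 ?addn0 // => j ji.
by case: (_ \in _); rewrite // mnmE (negbTE ji).
Qed.

Lemma edge_idealP C (p : S) :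
  edge_ideal K C p <-> {in msupp p, forall m, has_circuit C m}.
Proof.
split=> [/ideal_gen_msupp Cp m /Cp[g [k [[F FC ->]]]]|Cp].
  by rewrite prod_mesym1 msuppX inE => /eqP-> km; apply/exists_inP; exists F.
apply: ideal_gen_mon => m /Cp/exists_inP[F FC Fm].
by exists (mesym1 F) => //; exists F; rewrite ?prod_mesym1.
Qed.

Lemma has_circuit_le C m1 m2 : (m1 <= m2)%MM -> has_circuit C m1 -> has_circuit C m2.
Proof.
move=> le12 /exists_inP[F FC Fm]; apply/exists_inP; exists F => //.
exact: lepm_trans Fm le12.
Qed.

Lemma edge_ideal_mon C (F : {set 'I_n}) : F \in C -> edge_ideal K C 'X_[mesym1 F].
Proof.
move=> FC; apply/edge_idealP=> k; rewrite msuppX inE => /eqP->.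
by apply/exists_inP; exists F => //; apply: lepm_refl.
Qed.

Lemma edge_ideal_generated C : uniform3 C -> generated_in_degree (edge_ideal K C) 3.
Proof.
move=> C3 p; split=> [/edge_idealP Cp|/ideal_gen_msupp Cp].
  apply: ideal_gen_mon => m /Cp/exists_inP[F FC Fm]; exists (mesym1 F) => //.
  split; last by rewrite dhomogX /= mdeg_mesym1 C3.
  exact: edge_ideal_mon.
apply/edge_idealP=> m /Cp[g [k [[/edge_idealP Cg _] /Cg Ck km]]].
exact: has_circuit_le km Ck.
Qed.

(** The generating degree in [step_linear] is existentially quantified; a larger
degree than 3 is excluded by the monomial of a circuit, which cannot be a
multiple of anything of larger degree. *)
Lemma edge_ideal_degree C d : uniform3 C -> C <> set0 ->
  generated_in_degree (edge_ideal K C) d -> (d <= 3)%N.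
Proof.
move=> C3 /eqP/set0Pn[F FC] /(_ 'X_[mesym1 F])[/[swap] _ gen].
have /gen/ideal_gen_msupp/(_ (mesym1 F)) := edge_ideal_mon FC.
rewrite msuppX inE eqxx => /(_ isT)[g [k [[_ /dhomogP gd] /gd <- /mdeg_le]]].
by rewrite mdeg_mesym1 C3.
Qed.

Lemma edge_ideal_betti0 C j : uniform3 C -> (3 < j)%N -> is_betti (edge_ideal K C) 0 j 0.
Proof.
move=> C3 j3; apply: (betti0_eq0 (edge_idealP C)) => m /exists_inP[F FC /mnm_lepP Fm] mj.
suff [v Fv] : exists v, (mesym1 F v < m v)%N.
  exists v; apply/andP; split; first exact: leq_ltn_trans Fv.
  apply/exists_inP; exists F => //; apply/mnm_lepP=> u; rewrite mnmBE mnm1E.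
  case: eqP => [<-|_]; last by rewrite subn0.
  by rewrite -ltnS subn1 prednK //; apply: leq_ltn_trans Fv.
apply/existsP; apply: contraLR j3; rewrite negb_exists => /forallP mF.
rewrite -leqNgt -mj -(C3 F FC) -mdeg_mesym1; apply/mdeg_le/mnm_lepP=> v.
by rewrite leqNgt.
Qed.

Lemma gl_index_gt1 (I : S -> Prop) :
  enat_lt (Fin 1) (gl_index I) <-> step_linear 1 I.
Proof.
have [ub lub] := enat_supP (fun r => step_linear r I).
rewrite /gl_index; set s := enat_sup _ in ub lub *.
split=> [s1|/ub]; last by case: s {ub lub} => [[]|].
apply: NNPP => nI; have /lub : forall r, step_linear r I -> enat_le (Fin r) (Fin 0).
  (* For r > 0, [step_linear r] implies [step_linear 1]; without the latter the
     supremum would be 0. *)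
  case=> // r [d Id bI]; case: nI; exists d => // i j i1; apply: bI.
  exact: leq_trans i1 _.
by move: s1; case: s {ub lub} => [[|k]|].
Qed.

Lemma edge_step_linearP C : uniform3 C -> C <> set0 ->
  step_linear 1 (edge_ideal K C) <->
  (forall j, (4 < j)%N -> is_betti (edge_ideal K C) 1 j 0).
Proof.
move=> C3 CN0; split=> [[d /(edge_ideal_degree C3 CN0) d3 Cd] j j4|Cj].
  by apply: Cd => //; apply: leq_ltn_trans j4; rewrite addn1 ltnS.
exists 3 => [|[|[|//]] j _ j3]; first exact: edge_ideal_generated.
  exact: edge_ideal_betti0.
exact: Cj.
Qed.

End EdgeIdeal.

(** * Disconnected multidegrees of an edge ideal *)

Section EdgeGraph.

Variables (n : nat) (C : {set {set 'I_n}}).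
Hypothesis C3 : uniform3 C.
Implicit Types (F W : {set 'I_n}) (m : 'X_{1..n}).

Local Notation vertex := (koszul_vertex (has_circuit C)).
Local Notation edge := (koszul_edge (has_circuit C)).

Lemma edge_sym m : connect_sym (edge m).
Proof.
apply: sym_connect_sym => v w; rewrite /koszul_edge eq_sym mnm_subC.
by congr (_ && _); rewrite andbCA.
Qed.

(** A circuit F that survives in m / x_v joins v to every u such that x_u is not
used up by F. A u used up by neither F nor F' would connect v to w, so m has
no factor besides those of F and F'. *)
Lemma disconnected_multidegree m v w : vertex m v -> vertex m w ->
  ~~ connect (edge m) v w ->
  exists F F', [/\ F \in C, F' \in C, m = mesym1 (F :|: F'), v \in F' :\: F
                 & w \in F :\: F'].
Proof.
move=> /andP[mv /exists_inP[F FC /mnm_lepP Fm]].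
move=> /andP[mw /exists_inP[F' FC' /mnm_lepP Fm']] vw.
have step x H u : H \in C -> (0 < m x)%N ->
    (forall i, mesym1 H i <= (m - U_(x))%MM i)%N ->
    (u \in H < m u)%N -> connect (edge m) x u.
  move=> HC mx Hm Hu; have [->|xu] := eqVneq x u; first exact: connect0.
  apply: connect1; rewrite /koszul_edge xu mx (leq_ltn_trans _ Hu) //=.
  apply/exists_inP; exists H => //; apply/mnm_lepP=> i; have := Hm i.
  rewrite !mnmBE !mnm1E mnmE; case: (eqVneq u i) => [<-|_]; last by rewrite subn0.
  by rewrite (negbTE xu) subn0 => _; rewrite -ltnS subn1 prednK // (leq_ltn_trans _ Hu).
have le u : (m u <= (u \in F :|: F'))%N.
  rewrite leqNgt; apply/negP=> uW; case/negP: vw.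
  have uF : (u \in F < m u)%N by apply: leq_ltn_trans uW; rewrite inE; case: (u \in F).
  have uF' : (u \in F' < m u)%N.
    by apply: leq_ltn_trans uW; rewrite inE; case: (u \in F') => //; rewrite orbT.
  apply: connect_trans (step v F u FC mv Fm uF) _; rewrite edge_sym.
  exact: (step w F').
have mE : m = mesym1 (F :|: F').
  apply/mnmP=> u; apply/eqP; rewrite eqn_leq [X in (_ <= X)%N]mnmE le /= mnmE inE.
  have pos x H : (mesym1 H u <= (m - U_(x))%MM u)%N -> (u \in H <= m u)%N.
    by rewrite mnmE mnmBE => /leq_trans; apply; rewrite leq_subr.
  by have := pos _ _ (Fm u); have := pos _ _ (Fm' u); case: (u \in F); case: (u \in F').
exists F, F'; split=> //; rewrite inE.
  have vF : v \notin F.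
    apply/negP=> vF; have := Fm v; rewrite mnmE vF mnmBE mnm1E eqxx subn_gt0.
    by rewrite ltnNge mE mnmE leq_b1.
  by move: mv; rewrite vF mE mnmE inE (negbTE vF); case: (v \in F').
have wF : w \notin F'.
  apply/negP=> wF; have := Fm' w; rewrite mnmE wF mnmBE mnm1E eqxx subn_gt0.
  by rewrite ltnNge mE mnmE leq_b1.
by move: mw; rewrite wF mE mnmE inE (negbTE wF) orbF; case: (w \in F).
Qed.

Lemma koszul_connected_large j : (6 < j)%N -> koszul_connected (has_circuit C) j.
Proof.
move=> j6 m mj v w vv wv; apply/negPn/negP=> vw.
have [F [F' [FC FC' mE _ _]]] := disconnected_multidegree vv wv vw.
move: j6; rewrite -mj mE mdeg_mesym1 ltnNge (leq_trans (leq_card_setU _ _)) //.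
by rewrite !C3.
Qed.

Lemma vertex_sqfree W F v : F \in C -> F \subset W ->
  v \in W :\: F -> vertex (mesym1 W) v.
Proof.
move=> FC /subsetP FW; rewrite inE => /andP[vF vW].
rewrite /koszul_vertex mnmE vW; apply/exists_inP; exists F => //.
apply/mnm_lepP=> u; rewrite mnmBE !mnmE; have [uF|//] := boolP (u \in F).
by rewrite FW //; case: eqP vF => // ->; rewrite uF.
Qed.

Lemma edge_sqfree W v w :
  edge (mesym1 W) v w =
  [&& v != w, v \in W, w \in W & [exists F in C, F \subset W :\ v :\ w]].
Proof.
rewrite /koszul_edge !mnmE !lt0b; congr [&& _, _, _ & _].
rewrite /has_circuit; apply: eq_existsb => F; congr (_ && _).
apply/mnm_lepP/subsetP=> H u; have := H u; rewrite !inE !mnmBE !mnmE ![u == _]eq_sym;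
  case: (u \in F); case: (u \in W); case: (v == u); case: (w == u) => //=;
  by move/(_ isT).
Qed.

Lemma disconnected_by_closed_set W (A : {set 'I_n}) v w : v \in A -> w \notin A ->
  (forall F x y, F \in C -> F \subset W :\ x :\ y ->
     x \in A :&: W -> y \in W :\: A -> False) ->
  ~~ connect (edge (mesym1 W)) v w.
Proof.
move=> vA wA cl; apply: contra wA => /connectP[p]; elim: p v vA => [|u p IH] v vA /=.
  by move=> _ ->.
rewrite edge_sqfree => /andP[/and4P[vu vW uW /exists_inP[F FC FW]] up].
apply: (IH u _ up); apply/negPn/negP=> uA.
by apply: (cl F v u); rewrite // inE ?vA ?uA.
Qed.


(** In the complement clutter this is the bipyramid over F with apexes p and q:
its six faces are not circuits, its base F is one, and so is at least one of
the triples containing the axis p q. *)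
Definition split_bipyramid F (p q t : 'I_n) : Prop :=
  [/\ F \in C, t \in F, [&& p != q, p \notin F & q \notin F], [set p; q; t] \in C
    & forall x y, x \in [set p; q] -> y \in F -> x |: (F :\ y) \notin C].

Lemma card_rem F y : F \in C -> y \in F -> #|F :\ y| = 2.
Proof. by move=> FC yF; have := cardsD1 y F; rewrite yF (C3 FC) add1n => -[<-]. Qed.

(** The pair {p, q} is closed: an edge from it to y in F would be the complement
of the circuit consisting of the other apex and F minus y. *)
Lemma split_bipyramid_disconnected F p q t :
  split_bipyramid F p q t -> ~ koszul_connected (has_circuit C) 5.
Proof.
move=> [FC tF /and3P[pq pF qF] pqtC side].
have [w] : exists w, w \in F :\ t.
  by apply/set0Pn; rewrite -card_gt0 (card_rem FC tF).
rewrite !inE => /andP[wt wF] conn.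
pose W := p |: (q |: F).
have W5 : mdeg (mesym1 W) = 5.
  by rewrite mdeg_mesym1 !cardsU1 !inE negb_or pq pF qF (C3 FC).
have := conn _ W5 p w; case/(_ _ _)/idPn => //.
- apply: (vertex_sqfree FC); last by rewrite !inE eqxx pF.
  by apply/subsetP=> u uF; rewrite !inE uF !orbT.
- apply: (vertex_sqfree pqtC); last first.
    rewrite !inE wF (negbTE wt) !orbT orbF andbT.
    by apply/norP; split; apply: contraTneq wF => ->.
  by apply/subsetP=> u; rewrite !inE => /orP[/orP[/eqP->|/eqP->]|/eqP->];
    rewrite ?eqxx ?tF ?orbT.
apply: (disconnected_by_closed_set (A := [set p; q])).
- by rewrite !inE eqxx.
- by rewrite !inE; apply/norP; split; apply: contraTneq wF => ->.
move=> H x y HC HW; rewrite !inE => /andP[xA _] /andP[/norP[yp yq]].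
rewrite (negbTE yp) (negbTE yq) /= => yF.
have [z zA [zF zE]] : exists2 z, z \in [set p; q] &
    z \notin F /\ forall u, u \in [set p; q] -> u != x -> u = z.
  case/orP: xA => /eqP->; [exists q | exists p]; rewrite ?inE ?eqxx ?orbT //;
    by split=> // u; rewrite !inE => /orP[/eqP->|/eqP->] //; rewrite eqxx.
have HE : H = z |: (F :\ y).
  apply/eqP; rewrite eqEcard cardsU1 !inE (negbTE zF) andbF (card_rem FC yF) C3 //.
  rewrite andbT; apply/subsetP=> u /(subsetP HW); rewrite !inE => /and3P[-> ux].
  rewrite orbA => /orP[uA|->]; last by rewrite orbT.
  by rewrite (zE u _ ux) ?eqxx // !inE.
by have := side z y zA yF; rewrite -HE HC.
Qed.


Lemma connect_outside W H x y : H \in C -> H \subset W ->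
  x \in W :\: H -> y \in W :\: H -> connect (edge (mesym1 W)) x y.
Proof.
move=> HC /subsetP HW; rewrite !inE => /andP[xH xW] /andP[yH yW].
have [->|xy] := eqVneq x y; first exact: connect0.
apply: connect1; rewrite edge_sqfree xy xW yW; apply/exists_inP; exists H => //.
apply/subsetP=> u uH; rewrite !inE HW // andbT.
by apply/andP; split; apply: contraTneq uH => ->.
Qed.

(** With p, q the vertices of F' outside F, all joined to v through F, a circuit
made of one of p, q and two vertices of F would join the other apex, hence v,
to the third vertex of F. *)
Lemma split_bipyramid_of_separated F F' v : F \in C -> F' \in C -> #|F :|: F'| = 5 ->
  v \in F' :\: F ->
  {in F, forall y, ~~ connect (edge (mesym1 (F :|: F'))) v y} ->
  exists p q t, split_bipyramid F p q t.
Proof.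
move=> FC FC' W5 vF sep.
have I1 : #|F :&: F'| = 1.
  by apply: (@addnI 5); rewrite -[in LHS]W5 cardsUI !C3.
have /cards1P[t It] : #|F :&: F'| == 1 by rewrite I1.
have /cards2P[p [q [pq Dpq]]] : #|F' :\: F| == 2.
  by have := cardsID F F'; rewrite setIC I1 (C3 FC') add1n => -[->].
have /setIP[tF tF'] : t \in F :&: F' by rewrite It set11.
have inD x : x \in [set p; q] -> x \in (F :|: F') :\: F.
  by rewrite -Dpq !inE => /andP[-> ->]; rewrite orbT.
have pqF x : x \in [set p; q] -> x \notin F by move/inD; rewrite !inE => /andP[].
exists p, q, t; split=> //.
- by rewrite pq !pqF // !inE eqxx ?orbT.
- by rewrite -Dpq -It [F :&: F']setIC setUC setID.
move=> x y xpq yF; apply/negP=> HC; case/negP: (sep y yF).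
have [z zpq zx] : exists2 z, z \in [set p; q] & z != x.
  move: xpq; rewrite !inE => /orP[]/eqP->; [exists q | exists p];
    rewrite ?inE ?eqxx ?orbT //.
  by rewrite eq_sym.
apply: (@connect_trans _ _ z).
  apply: (connect_outside FC (subsetUl _ _)); last exact: inD.
  by move: vF; rewrite !inE => /andP[-> ->]; rewrite orbT.
apply: connect_outside HC _ _ _.
- have := inD x xpq; rewrite inE => /andP[_ xW].
  rewrite subUset sub1set xW; apply: subset_trans (subsetDl _ _) (subsetUl _ _).
- have := inD z zpq; rewrite !inE => /andP[/negbTE->] /= ->.
  by rewrite (negbTE zx) andbF.
rewrite !inE yF eqxx /= orbF andbT; apply: contraTneq yF => ->; exact: pqF.
Qed.

(** The circuits F and F' share one vertex o, and o cannot be connected both to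
v and to w. So one of F and F' is separated from the opposite vertex and is the
base of a bipyramid. *)
Lemma koszul_connected5 : (forall F p q t, ~ split_bipyramid F p q t) ->
  koszul_connected (has_circuit C) 5.
Proof.
move=> nsplit m mj v w vv wv; apply/negPn/negP=> vw.
have [F [F' [FC FC' mE vF wF]]] := disconnected_multidegree vv wv vw.
rewrite mE in mj vw; rewrite mdeg_mesym1 in mj.
have ns : forall H, ~ exists p q t, split_bipyramid H p q t.
  by move=> H [p [q [t]]]; apply: nsplit.
have [y yF vy] : exists2 y, y \in F & connect (edge (mesym1 (F :|: F'))) v y.
  apply: NNPP => ny; apply: (ns F);
  apply: (split_bipyramid_of_separated FC FC' mj vF) => y yF.
  by apply/negP=> vy; apply: ny; exists y.
apply: (ns F'); rewrite setUC in mj.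
apply: (split_bipyramid_of_separated FC' FC mj wF) => x xF'.
rewrite setUC; apply: contra vw => wx.
have [yF'|yF'] := boolP (y \in F'); last first.
  apply: connect_trans vy _.
  apply: (connect_outside FC' (subsetUr _ _)); first by rewrite !inE yF yF'.
  by move: wF; rewrite !inE => /andP[-> ->].
have [xF|xF] := boolP (x \in F); last first.
  rewrite edge_sym; apply: connect_trans wx _.
  apply: (connect_outside FC (subsetUl _ _)); first by rewrite !inE xF xF' orbT.
  by move: vF; rewrite !inE => /andP[-> ->]; rewrite orbT.
suff yx : y = x by rewrite -yx edge_sym in wx; apply: connect_trans vy wx.
have /card_le1_eqP : #|F :&: F'| <= 1.
  by rewrite -(leq_add2l 5) -[in X in X <= _]mj [F' :|: F]setUC cardsUI !C3.
by apply; rewrite inE ?xF ?yF.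
Qed.

(** In the complement clutter this is a copy of B' on the union of F and F'. *)
Definition isolated_pair F F' : Prop :=
  [/\ F \in C, F' \in C, [disjoint F & F']
    & forall H, H \in C -> H \subset F :|: F' -> H = F \/ H = F'].

Lemma isolated_pair_disconnected F F' :
  isolated_pair F F' -> ~ koszul_connected (has_circuit C) 6.
Proof.
move=> [FC FC' FF' only] conn.
have /set0Pn[w wF] : F != set0 by rewrite -card_gt0 C3.
have /set0Pn[v vF'] : F' != set0 by rewrite -card_gt0 C3.
have wF' : w \notin F' by rewrite (disjointFr FF').
have vF : v \notin F by rewrite (disjointFl FF').
have W6 : mdeg (mesym1 (F :|: F')) = 6.
  by rewrite mdeg_mesym1 cardsU disjoint_setI0 // cards0 !C3.
have := conn _ W6 v w; case/(_ _ _)/idPn => //.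
- by apply: (vertex_sqfree FC); rewrite ?subsetUl // !inE vF vF' orbT.
- by apply: (vertex_sqfree FC'); rewrite ?subsetUr // !inE wF wF'.
apply: (disconnected_by_closed_set vF' wF') => H x y HC HW.
rewrite !inE => /andP[xF' _] /andP[yF'].
rewrite (negbTE yF') orbF => yF.
have /(only H HC)[HE|HE] : H \subset F :|: F'.
  by apply: subset_trans HW _; apply: subset_trans (subsetDl _ _) (subsetDl _ _).
  by have := subsetP HW y; rewrite HE yF !inE eqxx => /(_ isT).
by have := subsetP HW x; rewrite HE xF' !inE eqxx andbF => /(_ isT).
Qed.


(** A third circuit misses some vertex of F and some vertex of F', hence joins
the two triangles of the graph, which lie on F and on F'. *)
Lemma koszul_connected6 : (forall F F', ~ isolated_pair F F') ->
  koszul_connected (has_circuit C) 6.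
Proof.
move=> niso m mj v w vv wv; apply/negPn/negP=> vw.
have [F [F' [FC FC' mE vF wF]]] := disconnected_multidegree vv wv vw.
rewrite mE in mj vw; rewrite mdeg_mesym1 in mj.
have FF' : [disjoint F & F'].
  by rewrite -setI_eq0 -cards_eq0 -(eqn_add2l 6) -[in X in X == _]mj cardsUI !C3.
apply: (niso F F'); split=> // H HC HW; apply: NNPP => /not_or_and[HF HF'].
have out G : G \in C -> H <> G -> exists2 a, a \in G & a \notin H.
  move=> GC HG; apply/subsetPn; apply: contra_notN HG => GH.
  by apply/esym/eqP; rewrite eqEcard GH !C3.
have [[a aF aH] [b bF bH]] := (out F FC HF, out F' FC' HF').
case/negP: vw; apply: (@connect_trans _ _ b).
  apply: (connect_outside FC (subsetUl _ _)).
    by move: vF; rewrite !inE => /andP[-> ->]; rewrite orbT.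
  by rewrite !inE bF orbT (disjointFl FF').
apply: (@connect_trans _ _ a).
  by apply: (connect_outside HC HW); rewrite !inE ?aH ?aF ?bH ?bF ?orbT.
apply: (connect_outside FC' (subsetUr _ _)).
  by rewrite !inE aF (disjointFr FF').
by move: wF; rewrite !inE => /andP[-> ->].
Qed.

End EdgeGraph.

(** * Induced copies in the complement clutter *)

Lemma card3P (T : finType) (F : {set T}) : #|F| = 3 ->
  exists a b c, [/\ F = [set a; b; c], a != b, a != c & b != c].
Proof.
have := set_enum F; have := enum_uniq (mem F); rewrite cardE.
case: (enum _) => [|a [|b [|c []]]] //=; rewrite !inE negb_or.
move=> /and3P[/andP[ab ac] bc _] <- _; exists a, b, c; split=> //.
by apply/setP=> x; rewrite !inE orbA.
Qed.

Lemma imset_inj_in (T V : finType) (g : T -> V) (U A B : {set T}) :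
  {in U &, injective g} -> A \subset U -> B \subset U -> g @: A = g @: B -> A = B.
Proof.
move=> gI; suff sub (A' B' : {set T}) : A' \subset U -> B' \subset U ->
    g @: A' = g @: B' -> A' \subset B'.
  by move=> AU BU E; apply/eqP; rewrite eqEsubset (sub A B) // (sub B A).
move=> /subsetP AU /subsetP BU E; apply/subsetP=> x xA.
have /imsetP[y yB xy] : g x \in g @: B' by rewrite -E imset_f.
by rewrite (gI x y (AU x xA) (BU y yB) xy).
Qed.

Lemma subset_imset_ex (T V : finType) (g : T -> V) (U : {set T}) (H : {set V}) :
  H \subset g @: U -> exists2 G : {set T}, G \subset U & g @: G = H.
Proof.
move=> HU; exists (U :&: g @^-1: H); first exact: subsetIl.
apply/setP=> v; apply/imsetP/idP=> [[t]|vH]; first by rewrite !inE => /andP[_ tH] ->.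
have /imsetP[t tU vE] := subsetP HU v vH.
by exists t; rewrite ?inE ?tU -?vE.
Qed.

(** A copy is easier to build and to use through a labelling g of vertices by the
vertices of D, that is, through the inverse of the bijection in
[has_induced_copy]; passing to the complement, membership in D means that the
image is not a circuit of C. The elements x0 and t0 are the values given outside
the copy. *)
Lemma has_induced_copy_complP (V T : finType) (C : {set {set V}}) (D : {set {set T}})
    (x0 : V) (t0 : T) : uniform3 D ->
  has_induced_copy (clutter_compl C) D <->
  exists2 g : T -> V, {in cover D &, injective g} &
    forall F : {set T}, F \subset cover D -> #|F| = 3 -> (F \in D) = (g @: F \notin C).
Proof.
move=> D3; split.
  move=> [W [f [fI fW DE]]].
  pose g t := odflt x0 [pick v in W | f v == t].
  have gP t : t \in cover D -> g t \in W /\ f (g t) = t.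
    rewrite -fW => /imsetP[v vW ->]; rewrite /g.
    case: pickP => [u /andP[uW /eqP]//|/(_ v)]; by rewrite vW eqxx.
  have gI : {in cover D &, injective g}.
    by move=> s t /gP[_ {2}<-] /gP[_ {2}<-] ->.
  exists g => // F FD F3.
  have F1 : f @: (g @: F) = F.
    rewrite -imset_comp -[RHS]imset_id; apply: eq_in_imset => t tF /=.
    by case: (gP t (subsetP FD t tF)).
  have gW : g @: F \subset W.
    by apply/subsetP=> _ /imsetP[t /(subsetP FD)/gP[gt _] ->].
  have g3 : #|g @: F| = 3.
    by rewrite card_in_imset // => s t /(subsetP FD) sD /(subsetP FD) tD; apply: gI.
  apply/idP/idP=> [|gC].
    rewrite -{1}DE => /imsetP[G]; rewrite !inE => /andP[/andP[_ GC] GW] FG.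
    by rewrite (_ : g @: F = G) //; apply: (imset_inj_in fI) => //; rewrite F1.
  by rewrite -DE -F1; apply: imset_f; rewrite !inE g3 eqxx gC.
move=> [g gI gD].
pose f v := odflt t0 [pick t in cover D | g t == v].
have fg t : t \in cover D -> f (g t) = t.
  move=> tD; rewrite /f; case: pickP => [s /andP[sD /eqP/gI->]//|/(_ t)].
  by rewrite tD eqxx.
have fgF (F : {set T}) : F \subset cover D -> f @: (g @: F) = F.
  move=> /subsetP FD; rewrite -imset_comp -[RHS]imset_id.
  by apply: eq_in_imset => t /FD/fg.
exists (g @: cover D), f; split; last 1 first.
- apply/setP=> F; apply/imsetP/idP=> [[G]|FD].
    rewrite !inE => /andP[/andP[/eqP G3 GC] GD].
    have [H HU HE] := subset_imset_ex GD.
    have H3 : #|H| = 3.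
      rewrite -G3 -HE card_in_imset // => s t /(subsetP HU) sD /(subsetP HU) tD.
      exact: gI.
    by move=> ->; rewrite -HE fgF // gD // HE.
  have FU : F \subset cover D by apply: bigcup_sup.
  exists (g @: F); last by rewrite fgF.
  rewrite !inE card_in_imset ?D3 // -?gD ?D3 // ?FD ?imsetS // => s t sF tF.
  by apply: gI; apply: (subsetP FU).
- by move=> _ _ /imsetP[s sD ->] /imsetP[t tD ->]; rewrite !fg // => ->.
- exact: fgF.
Qed.

(** Finite sets do not reduce, so the finite checks on triples of labels are made
on lists of booleans, which do. *)
Definition set7_code (G : {set 'I_7}) : seq bool :=
  [seq inord k \in G | k <- iota 0 7].

Definition triple_code (a b c : nat) : seq bool :=
  [seq k \in [:: a; b; c] | k <- iota 0 7].

Lemma in_tri a b c (i : 'I_7) : [&& a < 7, b < 7 & c < 7] ->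
  (i \in tri a b c) = ((i : nat) \in [:: a; b; c]).
Proof. by move=> /and3P[a7 b7 c7]; rewrite !inE -!val_eqE /= !inordK // orbA. Qed.

Lemma set7_code_inj : injective set7_code.
Proof.
move=> G H /eq_in_map E; apply/setP=> i.
by have := E i; rewrite mem_iota ltn_ord inord_val => ->.
Qed.

Lemma code_tri a b c : [&& a < 7, b < 7 & c < 7] ->
  set7_code (tri a b c) = triple_code a b c.
Proof.
move=> abc; apply/eq_in_map=> k; rewrite mem_iota => /andP[_ k7].
by rewrite in_tri // inordK.
Qed.

Lemma eq_triE G a b c : [&& a < 7, b < 7 & c < 7] ->
  (G == tri a b c) = (set7_code G == triple_code a b c).
Proof. by move=> abc; rewrite -code_tri // (inj_eq set7_code_inj). Qed.

Lemma card_set7 (G : {set 'I_7}) : #|G| = count id (set7_code G).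
Proof.
rewrite /set7_code count_map -sum1_count -sum1_card big_mkcond [RHS]big_mkcond.
rewrite -[iota 0 7]/(index_iota 0 7) big_mkord; apply: eq_bigr => i _.
by rewrite /= inord_val.
Qed.

(** The ten triples of {1, ..., 5}: the first four are those outside B, the other
six are the faces of B. *)
Lemma triple5 (G : {set 'I_7}) :
  #|G| = 3 -> inord 0 \notin G -> inord 6 \notin G ->
  G \in [:: tri 2 3 4; tri 1 4 5; tri 1 3 5; tri 1 2 5; tri 1 2 3; tri 1 2 4;
            tri 1 3 4; tri 2 3 5; tri 2 4 5; tri 3 4 5].
Proof.
rewrite card_set7 !inE !eq_triE // /set7_code /=.
case: (inord 0 \in G) (inord 6 \in G) => [|] [|] //= + _ _.
by do 5!case: (_ \in G).
Qed.

Lemma tri_eqE a b c a' b' c' :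
  [&& a < 7, b < 7 & c < 7] -> [&& a' < 7, b' < 7 & c' < 7] ->
  (tri a b c == tri a' b' c') = (triple_code a b c == triple_code a' b' c').
Proof. by move=> abc abc'; rewrite eq_triE // code_tri. Qed.

Lemma card_tri a b c : [&& a < 7, b < 7 & c < 7] -> uniq [:: a; b; c] ->
  #|tri a b c| = 3.
Proof.
move=> /and3P[a7 b7 c7]; rewrite /= !inE negb_or => /and3P[/andP[ab ac] bc _].
by rewrite /tri -setUA !cardsU1 cards1 !inE negb_or -!val_eqE /= !inordK // ab ac bc.
Qed.

(** * The clutters B, B1, B2 and B' *)

Lemma clB_sub_clB1 : clB \subset clB1.
Proof. exact: subsetUl. Qed.

Lemma clB1_sub_clB2 : clB1 \subset clB2.
Proof. by apply: setUS; rewrite sub1set !inE eqxx. Qed.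

Lemma mem_clB2 (F : {set 'I_7}) : F \in clB2 ->
  [/\ #|F| = 3, inord 0 \notin F & inord 6 \notin F].
Proof.
rewrite !inE => FB.
by repeat (case/orP: FB => FB); rewrite (eqP FB); split;
  rewrite ?card_tri ?in_tri ?inordK.
Qed.

Section Copies.

Variables (n : nat) (C : {set {set 'I_n}}).
Hypothesis C3 : uniform3 C.

(** The three bipyramids are treated at once, as a clutter D between B and B2;
the base 234 and the triple 145 lie in none of them. *)

Section Bipyramids.

Variable D : {set {set 'I_7}}.
Hypotheses (BD : clB \subset D) (DB2 : D \subset clB2).

Lemma bip_uniform : uniform3 D.
Proof. by move=> F /(subsetP DB2)/mem_clB2[]. Qed.

Lemma bip_cover (i : 'I_7) : (i \in cover D) = (0 < i < 6).
Proof.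
apply/idP/idP=> [/bigcupP[F /(subsetP DB2)/mem_clB2[_ F0 F6] iF]|].
  rewrite lt0n ltn_neqAle -ltnS ltn_ord andbT; apply/andP.
  by split; apply/eqP=> iE; move: iF; rewrite -[i]inord_val iE; apply/negP.
have inB a b c : [&& a < 7, b < 7 & c < 7] -> tri a b c \in clB ->
    (i : nat) \in [:: a; b; c] -> i \in cover D.
  by move=> abc tB ia; apply/bigcupP; exists (tri a b c); rewrite ?(subsetP BD) ?in_tri.
have [B123 B245] : tri 1 2 3 \in clB /\ tri 2 4 5 \in clB by rewrite !inE !eqxx ?orbT.
move: (inB 1 2 3 isT B123) (inB 2 4 5 isT B245).
case: (i : nat) => [|[|[|[|[|[|]]]]]] //= H H' _;
  by [apply: H | apply: H'].
Qed.

Lemma split_bipyramid_of_copy : (0 < n) -> has_induced_copy (clutter_compl C) D ->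
  exists F p q t, split_bipyramid C F p q t.
Proof.
move=> n0; rewrite (has_induced_copy_complP C (Ordinal n0) ord0 bip_uniform).
move=> [g gI gD].
have cov k : 0 < k < 6 -> inord k \in cover D.
  by move=> k6; rewrite bip_cover inordK //; case/andP: k6 => _ /ltnW.
have lt7 a b c : [&& 0 < a < 6, 0 < b < 6 & 0 < c < 6] -> [&& a < 7, b < 7 & c < 7].
  move=> /and3P[/andP[_ a6] /andP[_ b6] /andP[_ c6]].
  by rewrite (ltn_trans a6) ?(ltn_trans b6) ?(ltn_trans c6).
have covT a b c : [&& 0 < a < 6, 0 < b < 6 & 0 < c < 6] -> tri a b c \subset cover D.
  move=> /and3P[a6 b6 c6]; apply/subsetP=> i; rewrite !inE.
  by case/orP=> [/orP[]|]/eqP->; apply: cov.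
have out a b c : [&& 0 < a < 6, 0 < b < 6 & 0 < c < 6] -> uniq [:: a; b; c] ->
    tri a b c \notin clB2 -> g @: tri a b c \in C.
  move=> abc uabc tB; apply/negPn; rewrite -gD ?covT ?card_tri ?lt7 //.
  by apply: contra tB; apply: (subsetP DB2).
have gN j k : 0 < j < 6 -> 0 < k < 6 -> j != k -> g (inord j) != g (inord k).
  move=> j6 k6; apply: contraNneq => /gI E; have := E (cov _ j6) (cov _ k6).
  case/andP: j6 => _ /ltnW j7; case/andP: k6 => _ /ltnW k7.
  by move=> /(congr1 val) /=; rewrite !inordK // => ->.
have imgT a b c : g @: tri a b c = [set g (inord a); g (inord b); g (inord c)].
  by rewrite /tri !imsetU !imset_set1.
exists (g @: tri 2 3 4), (g (inord 1)), (g (inord 5)), (g (inord 4)); split.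
- by apply: out; rewrite // ?inE ?tri_eqE.
- by rewrite imset_f // in_tri // inordK.
- by rewrite gN //= imgT !inE !(negbTE (gN _ _ _ _ _)).
- by rewrite -imgT; apply: out; rewrite // ?inE ?tri_eqE.
have side a b c : [&& 0 < a < 6, 0 < b < 6 & 0 < c < 6] -> uniq [:: a; b; c] ->
    tri a b c \in clB -> g @: tri a b c \notin C.
  by move=> abc uabc tB; rewrite -gD ?(subsetP BD) ?covT ?card_tri ?lt7.
have rem a b c (x : 'I_n) : [&& 0 < a < 6, 0 < b < 6 & 0 < c < 6] -> uniq [:: a; b; c] ->
    x |: (g @: tri a b c :\ g (inord a)) = [set x; g (inord b); g (inord c)].
  move=> /and3P[a6 b6 c6]; rewrite /= !inE negb_or => /and3P[/andP[ab ac] _ _].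
  by rewrite imgT -setUA setU1K ?setUA // !inE negb_or !gN.
(* [rem] removes the first listed vertex, so each vertex of 234 is put first. *)
have [E3 E4] : tri 2 3 4 = tri 3 2 4 /\ tri 2 3 4 = tri 4 2 3.
  by split; apply/eqP; rewrite tri_eqE.
move=> x y; rewrite imgT !inE => xE yE; rewrite -imgT.
suff face a b c : [&& 0 < a < 6, 0 < b < 6 & 0 < c < 6] ->
    [&& uniq [:: a; b; c], uniq [:: 1; b; c] & uniq [:: 5; b; c]] ->
    tri 1 b c \in clB -> tri 5 b c \in clB ->
    x |: (g @: tri a b c :\ g (inord a)) \notin C.
  case/orP: yE => [/orP[]|] /eqP->; [|rewrite E3|rewrite E4];
    by apply: face; rewrite // ?inE ?tri_eqE.
move=> abc /and3P[uabc u1 u5] t1 t5; rewrite rem //.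
by case/orP: xE => /eqP->; rewrite -imgT; apply: side => //; case/and3P: abc => _ -> ->.
Qed.

End Bipyramids.

(** Writing F as r s t, the triples p q r and p q s may or may not be circuits. By
the symmetry of r and s, the first may be assumed to imply the second. With the
labels p, r, s, t, q = 1, 2, 3, 4, 5, the three remaining cases give B, B1, B2. *)
Lemma copy_of_split_bipyramid F p q t : split_bipyramid C F p q t ->
  exists2 D, D \in famC & has_induced_copy (clutter_compl C) D.
Proof.
move=> [FC tF /and3P[pq pF qF] pqtC side].
have /cards2P[r [s [rs rsE]]] : #|F :\ t| == 2 by rewrite (card_rem C3).
have FE : F = [set r; s; t] by rewrite -(setD1K tF) rsE setUC.
have [rt st] : r != t /\ s != t.
  have : r \in F :\ t by rewrite rsE !inE eqxx.
  have : s \in F :\ t by rewrite rsE !inE eqxx orbT.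
  by rewrite !inE => /andP[-> _] /andP[-> _].
have face x y z : x \in [set p; q] -> y \in F -> z \in F -> y != z ->
    ([set x; y; z] \in C) = false.
  move=> xpq yF zF yz.
  have xF : x \notin F by move: xpq; rewrite !inE => /orP[]/eqP->.
  have [w wF wE] : exists2 w, w \in F & F :\ w = [set y; z].
    have [w] : exists w, w \in (F :\ y) :\ z.
      apply/set0Pn; rewrite -card_gt0.
      have := cardsD1 z (F :\ y).
      by rewrite (card_rem C3 FC yF) !inE eq_sym yz zF add1n => -[<-].
    rewrite !inE => /and3P[wz wy wF]; exists w => //.
    apply/esym/eqP; rewrite eqEcard (card_rem C3 FC wF) cards2 yz andbT.
    by rewrite subUset !sub1set !inE yF zF ![_ == w]eq_sym wz wy.
  by have := side x w xpq wF; rewrite wE setUA => /negbTE.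
wlog rs_imp : r s rs rsE FE rt st / [set p; r; q] \in C -> [set p; s; q] \in C.
  move=> wl; have [/implyP|] := boolP (([set p; r; q] \in C) ==> ([set p; s; q] \in C)).
    by apply: wl.
  rewrite negb_imply => /andP[rC sC]; apply: (wl s r) => //.
  - by rewrite eq_sym.
  - by rewrite rsE setUC.
  - by rewrite FE [[set r; s]]setUC.
have [rF sF] : r \in F /\ s \in F by rewrite FE !inE !eqxx ?orbT.
(* Labels start at 1, hence the shift. *)
pose S := [:: p; r; s; t; q]; pose g (i : 'I_7) := nth p S i.-1.
have uS : uniq S.
  have neq x y : x \notin F -> y \in F -> x != y.
    by move=> xF yF; apply: contraNneq xF => ->.
  rewrite /= !inE !negb_or pq rs rt st ![_ == q]eq_sym.
  by rewrite !(neq p) ?(neq q).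
have imgT a b c : a < 7 -> b < 7 -> c < 7 ->
    g @: tri a b c = [set nth p S a.-1; nth p S b.-1; nth p S c.-1].
  by move=> a7 b7 c7; rewrite /tri !imsetU !imset_set1 /g !inordK.
have [pA qA] : p \in [set p; q] /\ q \in [set p; q] by rewrite !inE !eqxx orbT.
have ptq : [set p; t; q] \in C by rewrite -setUA [[set t; q]]setUC setUA.
(* In all cases D is determined by its two undecided triples 125 and 135. *)
suff copyD (D : {set {set 'I_7}}) : clB \subset D -> D \subset clB2 ->
    (tri 1 2 5 \in D) = ([set p; r; q] \notin C) ->
    (tri 1 3 5 \in D) = ([set p; s; q] \notin C) -> has_induced_copy (clutter_compl C) D.
  have [BB1 B12] := (clB_sub_clB1, clB1_sub_clB2).
  have B02 := subset_trans BB1 B12.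
  have [rC|rC] := boolP ([set p; r; q] \in C).
    exists clB; first by rewrite !inE eqxx.
    by apply: copyD; rewrite ?rs_imp ?rC // ?inE ?tri_eqE.
  have [sC|sC] := boolP ([set p; s; q] \in C).
    exists clB1; first by rewrite !inE eqxx orbT.
    by apply: copyD; rewrite ?sC ?rC // ?inE ?tri_eqE.
  exists clB2; first by rewrite !inE eqxx !orbT.
  by apply: copyD; rewrite ?sC ?rC // ?inE ?tri_eqE.
move=> BD DB D125 D135.
apply/(has_induced_copy_complP C p ord0 (bip_uniform DB)); exists g.
  move=> i j; rewrite !bip_cover // => /andP[i0 i6] /andP[j0 j6] /eqP.
  have lt5 k : 0 < k -> k < 6 -> k.-1 < size S by case: k.
  rewrite /g nth_uniq ?lt5 //.
  by move=> /eqP/(congr1 succn); rewrite !prednK // => /val_inj.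
move=> G GD G3.
have GN k : k < 7 -> ~~ (0 < k < 6) -> inord k \notin G.
  move=> k7; apply: contra => /(subsetP GD); by rewrite bip_cover // inordK.
have := triple5 G3 (GN 0 isT isT) (GN 6 isT isT).
have [b234 b154] : tri 2 3 4 \notin clB2 /\ tri 1 4 5 \notin clB2.
  by rewrite !inE !tri_eqE.
have inD a b c : tri a b c \in clB -> tri a b c \in D by apply: (subsetP BD).
have notD a b c : tri a b c \notin clB2 -> (tri a b c \in D) = false.
  by move=> tB; apply: contraNF tB; apply: (subsetP DB).
rewrite !inE; repeat case/orP; move/eqP->; rewrite imgT //=.
- by rewrite notD // -FE FC.
- by rewrite notD // ptq.
- by rewrite inD ?face // !inE !tri_eqE.
- by rewrite inD ?face // !inE !tri_eqE.
- by rewrite inD ?face // !inE !tri_eqE.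
- by rewrite setUC setUA inD ?face // !inE !tri_eqE.
- by rewrite setUC setUA inD ?face // !inE !tri_eqE.
- by rewrite setUC setUA inD ?face // !inE !tri_eqE.
Qed.


Lemma mem_clB' (F : {set 'I_7}) :
  (F \in clB') = [&& #|F| == 3, ord0 \notin F, F != tri 1 2 3 & F != tri 4 5 6].
Proof. by rewrite !inE negb_or andbC -andbA. Qed.

Lemma clB'_uniform : uniform3 clB'.
Proof. by move=> F; rewrite mem_clB' => /and4P[/eqP]. Qed.

Lemma ord0_tri a b c : [&& 0 < a < 7, 0 < b < 7 & 0 < c < 7] -> ord0 \notin tri a b c.
Proof.
move=> /and3P[/andP[a0 a7] /andP[b0 b7] /andP[c0 c7]].
by rewrite in_tri ?a7 ?b7 // !inE /=; case: a b c a0 b0 c0 {a7 b7 c7} => [|a] [|b] [|c].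
Qed.

Lemma tri_sub a b c : [&& 0 < a < 7, 0 < b < 7 & 0 < c < 7] ->
  tri a b c \subset [set~ ord0].
Proof.
move=> abc; apply/subsetP=> i iT; rewrite !inE.
by apply: contraTneq iT => ->; apply: ord0_tri.
Qed.

Lemma cover_clB' : cover clB' = [set~ ord0].
Proof.
apply/setP=> i; rewrite !inE; apply/idP/idP=> [/bigcupP[F]|i0].
  by rewrite mem_clB' => /and4P[_ F0 _ _] iF; apply: contraNneq F0 => <-.
have inB a b c : [&& 0 < a < 7, 0 < b < 7 & 0 < c < 7] -> uniq [:: a; b; c] ->
    triple_code a b c != triple_code 1 2 3 -> triple_code a b c != triple_code 4 5 6 ->
    (i : nat) \in [:: a; b; c] -> i \in cover clB'.
  move=> abc uabc n123 n456 iabc; have abc7 : [&& a < 7, b < 7 & c < 7].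
    by case/and3P: abc => /andP[_ ->] /andP[_ ->] /andP[_ ->].
  apply/bigcupP; exists (tri a b c); last by rewrite in_tri.
  by rewrite mem_clB' card_tri // ord0_tri // !tri_eqE // n123.
move: i0 (ltn_ord i) (inB 1 2 4 isT isT isT isT) (inB 3 5 6 isT isT isT isT).
rewrite -val_eqE /=.
by case: (i : nat) => [|[|[|[|[|[|[|]]]]]]] //= _ _ H H';
  by [apply: H | apply: H'].
Qed.

Lemma isolated_pair_of_copy : 0 < n -> has_induced_copy (clutter_compl C) clB' ->
  exists F F', isolated_pair C F F'.
Proof.
move=> n0; rewrite (has_induced_copy_complP C (Ordinal n0) ord0 clB'_uniform).
rewrite cover_clB' => -[g gI gD].
have [s123 s456] := (@tri_sub 1 2 3 isT, @tri_sub 4 5 6 isT).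
exists (g @: tri 1 2 3), (g @: tri 4 5 6); split.
- by apply/negPn; rewrite -gD ?card_tri // mem_clB' !eqxx /= ?andbF.
- by apply/negPn; rewrite -gD ?card_tri // mem_clB' !eqxx /= ?andbF.
- rewrite -setI_eq0; apply/eqP/setP=> v; rewrite !inE; apply/negP.
  move=> /andP[/imsetP[i iT ->] /imsetP[j jT]].
  move=> /(gI i j (subsetP s123 i iT) (subsetP s456 j jT)) ij.
  by move: iT jT; rewrite ij !in_tri //; case: (j : nat) => [|[|[|[|[|[|[|]]]]]]].
move=> H HC; rewrite -imsetU => /subset_imset_ex[G GT HG].
have GU : G \subset [set~ ord0] by apply: subset_trans GT _; rewrite subUset s123.
have G3 : #|G| = 3.
  apply: etrans (C3 HC); rewrite -HG card_in_imset // => i j /(subsetP GU) iU /(subsetP GU) jU.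
  exact: gI.
have := gD G GU G3; rewrite HG HC mem_clB' G3 eqxx /=.
have -> /= : ord0 \notin G by apply: contraT => /negPn/(subsetP GU); rewrite !inE eqxx.
by move/negbT; rewrite negb_and !negbK => /orP[]/eqP GE; [left|right]; rewrite -HG GE.
Qed.

Lemma copy_of_isolated_pair F F' : isolated_pair C F F' ->
  has_induced_copy (clutter_compl C) clB'.
Proof.
move=> [FC FC' dFF' only].
have [a [b [c [FE ab ac bc]]]] := card3P (C3 FC).
have [d [e [f [FE' de df ef]]]] := card3P (C3 FC').
pose S := [:: a; b; c; d; e; f]; pose g (i : 'I_7) := nth a S i.-1.
have neq x y : x \in F -> y \in F' -> x != y.
  by move=> xF yF'; apply: contraTneq xF => ->; rewrite (disjointFl dFF').
have uS : uniq S.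
  by rewrite /= !inE !negb_or ab ac bc de df ef !neq // ?FE ?FE' !inE ?eqxx ?orbT.
have imgT i j k : i < 7 -> j < 7 -> k < 7 ->
    g @: tri i j k = [set nth a S i.-1; nth a S j.-1; nth a S k.-1].
  by move=> i7 j7 k7; rewrite /tri !imsetU !imset_set1 /g !inordK.
have [g123 g456] : g @: tri 1 2 3 = F /\ g @: tri 4 5 6 = F' by rewrite !imgT.
have gI : {in [set~ ord0] &, injective g}.
  move=> i j; rewrite !inE -!val_eqE -!lt0n /= => i0 j0 /eqP.
  have lt6 (k : 'I_7) : 0 < k -> k.-1 < size S by case: k => [[|k]].
  by rewrite /g nth_uniq ?lt6 // => /eqP/(congr1 succn); rewrite !prednK // => /val_inj.
have [s123 s456] := (@tri_sub 1 2 3 isT, @tri_sub 4 5 6 isT).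
apply/(has_induced_copy_complP C a ord0 clB'_uniform); exists g; rewrite cover_clB' //.
move=> G GU G3; rewrite mem_clB' G3 eqxx /=.
have -> /= : ord0 \notin G by apply: contraT => /negPn/(subsetP GU); rewrite !inE eqxx.
have [->|n123] /= := eqVneq G (tri 1 2 3); first by rewrite g123 FC.
have [->|n456] /= := eqVneq G (tri 4 5 6); first by rewrite g456 FC'.
apply/esym/negP=> gC; have : g @: G \subset F :|: F'.
  rewrite -g123 -g456 -imsetU imsetS //; apply/subsetP=> i /(subsetP GU).
  rewrite in_setU !in_tri // in_setC in_set1 -val_eqE /=; case: i => i /=.
  by do 7!case: i => [|i] //.
case/(only _ gC) => gE.
  by case/eqP: n123; apply: (imset_inj_in gI) => //; rewrite gE g123.
by case/eqP: n456; apply: (imset_inj_in gI) => //; rewrite gE g456.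
Qed.

Lemma free_koszul_connected : C <> set0 ->
  clutter_free famC (clutter_compl C) <->
  koszul_connected (has_circuit C) 5 /\ koszul_connected (has_circuit C) 6.
Proof.
move=> /eqP/set0Pn[F0 F0C]; have n0 : 0 < n.
  have /card_gt0P[v _] : 0 < #|F0| by rewrite C3.
  by apply: leq_ltn_trans (ltn_ord v).
split=> [free|[conn5 conn6] D].
  split.
    by apply: koszul_connected5 => // F p q t /copy_of_split_bipyramid[D DF]; apply: free.
  apply: koszul_connected6 => // F F' /copy_of_isolated_pair; apply: free.
  by rewrite !inE eqxx !orbT.
have nosplit (D' : {set {set 'I_7}}) : clB \subset D' -> D' \subset clB2 ->
    ~ has_induced_copy (clutter_compl C) D'.
  move=> BD DB /(split_bipyramid_of_copy BD DB n0)[F [p [q [t]]]].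
  by move=> /split_bipyramid_disconnected; apply.
have [BB1 B12] := (clB_sub_clB1, clB1_sub_clB2).
rewrite !inE -!orbA => /or4P[] /eqP->.
- by apply: nosplit => //; apply: subset_trans B12.
- exact: nosplit.
- by apply: nosplit => //; apply: subset_trans B12.
by move/(isolated_pair_of_copy n0) => [F [F' /isolated_pair_disconnected]]; apply.
Qed.

End Copies.

Theorem theorem2p2 (K : fieldType) (n : nat) (C : {set {set 'I_n}})
    (hunif : uniform3 C) (hcover : cover C = [set: 'I_n]) (hne : C <> set0) :
  (clutter_free famC (clutter_compl C) <-> enat_lt (Fin 1) (gl_index (edge_ideal K C))) /\
  (enat_lt (Fin 1) (gl_index (edge_ideal K C)) <->
     is_betti (edge_ideal K C) 1 5 0 /\ is_betti (edge_ideal K C) 1 6 0).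
Proof.
have betti1 j : is_betti (edge_ideal K C) 1 j 0 <-> koszul_connected (has_circuit C) j.
  by split; [apply: connected_of_betti1_eq0 | apply: betti1_eq0_of_connected];
    apply: edge_idealP.
have index_betti : enat_lt (Fin 1) (gl_index (edge_ideal K C)) <->
    is_betti (edge_ideal K C) 1 5 0 /\ is_betti (edge_ideal K C) 1 6 0.
  rewrite gl_index_gt1 (edge_step_linearP K hunif hne); split=> [b1|[b5 b6] j].
    by split; apply: b1.
  rewrite leq_eqVlt => /orP[/eqP<-//|]; rewrite leq_eqVlt => /orP[/eqP<-//|j6].
  exact/betti1/koszul_connected_large.
by split=> //; rewrite index_betti !betti1; apply: free_koszul_connected.
Qed.
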